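(* Let $V$ be an optimal prefix-free machine, and for real $T>0$ let $\Theta_V(T)=\sum_{s\in\{0,1\}^*,\,H_V(s)<|s|}2^{-|s|/T}$. For every $T\in(0,1)$, if $\Theta_V(T)$ is computable, then $T$ is weakly Chaitin $T$-random and $T$-compressible.
   Context: $\{0,1\}^*$ is the set of finite binary strings; $|s|$ is the length of $s$. A prefix-free machine is a partial recursive function $C:\{0,1\}^*\to\{0,1\}^*$ whose domain is prefix-free. $H_C(s)=\min\{|p| : C(p)=s\}$ (possibly $\infty$). A prefix-free machine $U$ is optimal if for every prefix-free machine $C$ there is $d\in\mathbb{N}$ such that for every $p\in\mathrm{Dom}\,C$ there is $q\in\mathrm{Dom}\,U$ with $U(q)=C(p)$ and $|q|\le|p|+d$. A particular optimal prefix-free machine $U$ is fixed and $H(s):=H_U(s)$. For a real $\alpha$ and $n\ge1$, $\alpha\restriction n$ denotes the first $n$ bits of the base-two expansion of $\alpha-\lfloor\alpha\rfloor$ (the expansion with infinitely many zeros). A real $\alpha$ is computable if there is a total recursive $f:\mathbb{N}^+\to\mathbb{Q}$ with $|\alpha-f(n)|<1/n$ for all $n$. For $T\in(0,1]$, $\alpha$ is weakly Chaitin $T$-random if there is $c\in\mathbb{N}$ with $Tn-c\le H(\alpha\restriction n)$ for all $n\in\mathbb{N}^+$; $\alpha$ is $T$-compressible if $\limsup_{n\to\infty}H(\alpha\restriction n)/n\le T$. *)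

(* Defs.v *)
From Stdlib Require Import Reals Lra Lia ZArith List.
From Stdlib Require Import ClassicalEpsilon.
From Coquelicot Require Import Coquelicot.
Import ListNotations.
Open Scope R_scope.

(* A term evaluated on an argument list of any length; surplus        *)
(* arguments are simply ignored by the base functions.                *)
Inductive mrec : Type :=
| MZero : mrec
| MSucc : mrec
| MProj : nat -> mrec
| MComp : mrec -> list mrec -> mrec
| MPrec : mrec -> mrec -> mrec
| MMu   : mrec -> mrec.

Inductive eval : mrec -> list nat -> nat -> Prop :=
| ev_zero : forall v, eval MZero v 0
| ev_succ : forall x v, eval MSucc (x :: v) (S x)
| ev_proj : forall i v, (i < length v)%nat -> eval (MProj i) v (nth i v 0%nat)
| ev_comp : forall f gs v ws y,
    evals gs v ws -> eval f ws y -> eval (MComp f gs) v y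
| ev_prec0 : forall f g v y, eval f v y -> eval (MPrec f g) (0%nat :: v) y
| ev_precS : forall f g n v z y,
    eval (MPrec f g) (n :: v) z -> eval g (n :: z :: v) y ->
    eval (MPrec f g) (S n :: v) y
| ev_mu : forall f v n,
    eval f (n :: v) 0%nat ->
    (forall m, (m < n)%nat -> exists k, eval f (m :: v) (S k)) ->
    eval (MMu f) v n
with evals : list mrec -> list nat -> list nat -> Prop :=
| evs_nil : forall v, evals [] v []
| evs_cons : forall g gs v y ys,
    eval g v y -> evals gs v ys -> evals (g :: gs) v (y :: ys).

(* Binary strings and their standard bijection with nat:              *)
(* s |-> (the number with binary digits 1s) - 1.                      *)
Definition bstring := list bool.

Definition enc (s : bstring) : nat :=
  (fold_left (fun acc (b : bool) => 2 * acc + (if b then 1 else 0)) s 1 - 1)%nat.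

Definition run (e : mrec) (p s : bstring) : Prop := eval e [enc p] (enc s).

Definition is_prefix (p q : bstring) : Prop := exists r, q = p ++ r.

Definition prefix_free (e : mrec) : Prop :=
  forall p q s t, run e p s -> run e q t -> is_prefix p q -> p = q.

Definition optimal (U : mrec) : Prop :=
  prefix_free U /\
  forall C : mrec, prefix_free C ->
    exists d : nat, forall p s, run C p s ->
      exists q, run U q s /\ (length q <= length p + d)%nat.

Definition HC (C : mrec) (s : bstring) : Rbar :=
  match excluded_middle_informative (exists p, run C p s) with
  | left _ =>
      Finite (INR (epsilon (inhabits 0%nat)
        (fun k => (exists p, run C p s /\ length p = k) /\
                  forall p, run C p s -> (k <= length p)%nat)))
  | right _ => p_infty
  end.

Fixpoint all_strings (n : nat) : list bstring :=
  match n with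
  | O => [[]]
  | S m => map (cons false) (all_strings m) ++ map (cons true) (all_strings m)
  end.

Definition Theta (V : mrec) (T : R) : R :=
  Series (fun n : nat =>
    fold_right Rplus 0
      (map (fun s => if excluded_middle_informative
                          (Rbar_lt (HC V s) (INR (length s)))
                     then Rpower 2 (- INR (length s) / T) else 0)
           (all_strings n))).

(* Standard bijection nat -> nat * nat (inverse of Cantor pairing). *)
Fixpoint unpair (m : nat) : nat * nat :=
  match m with
  | O => (0%nat, 0%nat)
  | S m' => let (x, y) := unpair m' in
            match x with
            | O => (S y, 0%nat)
            | S x' => (x', S y)
            end
  end.

Definition zig (a : nat) : Z :=
  if Nat.even a then Z.of_nat (Nat.div2 a) else (- Z.of_nat (Nat.div2 (S a)))%Z.

Definition decode_rat (m : nat) : R :=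
  let (a, b) := unpair m in IZR (zig a) / INR (S b).

Definition computable_real (alpha : R) : Prop :=
  exists e : mrec,
    (forall n : nat, (1 <= n)%nat -> exists m, eval e [n] m) /\
    (forall n m : nat, (1 <= n)%nat -> eval e [n] m ->
        Rabs (alpha - decode_rat m) < 1 / INR n).

(* i-th bit (i >= 1) of the base-two expansion of frac(alpha) with
   infinitely many zeros. *)
Definition bit (alpha : R) (i : nat) : bool :=
  Z.odd (Int_part (frac_part alpha * 2 ^ i)).

Definition restr (alpha : R) (n : nat) : bstring :=
  map (bit alpha) (seq 1 n).

Definition weakly_Chaitin_random (U : mrec) (T alpha : R) : Prop :=
  exists c : nat, forall n : nat, (1 <= n)%nat ->
    Rbar_le (Finite (T * INR n - INR c)) (HC U (restr alpha n)).

(* T-compressibility: limsup_n H(alpha|n)/n <= T, unfolded as: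
   for every eps > 0, eventually H(alpha|n) <= (T + eps) n. *)
Definition T_compressible (U : mrec) (T alpha : R) : Prop :=
  forall eps : R, 0 < eps -> exists N : nat, forall n : nat, (N <= n)%nat ->
    Rbar_le (HC U (restr alpha n)) (Finite ((T + eps) * INR n)).

(* Main.v *)
(* Call [s] compressible when [H_V(s) < |s|]; the compressible strings are enumerated
   in finite stages, and [stage k t] is the part of [Theta_V(t)] seen at stage [k].
   Since [Theta_V(T)] is computable, strict inequalities between it and [stage k t], for
   rational [t], are semi-decidable.

   Randomness: from [T|n] compute [t] with [T < t <= T + 2^-n] and search for [k] with
   [stage k t > Theta_V(T)].  As [stage k] is Lipschitz uniformly in [k], the part of
   [Theta_V(T)] missed at stage [k] is [O(2^-n)], so every compressible string of length
   at most [Tn - O(1)] has been seen.  Any other string of about that length is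
   incompressible, whence [H(T|n) >= Tn - O(1)].

   Compressibility: fix a rational [r] in [(T, 1)].  The first [m] bits of [Theta_V(r)]
   give a stage [k] missing at most [2 * 2^-m] at temperature [r], hence at most
   [(2 * 2^-m)^(r/T)] at temperature [T].  For [m] slightly above [n T/r] this is
   [o(2^-n)], and comparing [stage k] with [Theta_V(T)] determines [T|n] up to four
   candidates.  As [r] tends to [1], [m/n] tends to [T].  Working at [r < 1] makes
   Kraft's inequality unnecessary: [Theta_V(r)] converges by counting strings. *)

Require Import Defs.
From Stdlib Require Import Reals Lra Lia ZArith List Arith Classical ClassicalEpsilon.
From Coquelicot Require Import Coquelicot.
Import ListNotations.
Open Scope R_scope.
Open Scope bool_scope.
Open Scope nat_scope.

(** * Recursive functions *)

(** Both halves need prefix-free machines given as explicit [mrec] terms. For randomness the machine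
    is a search composed with [U], so its domain lies inside that of [U]. For compressibility the
    inputs are [1^j 0 w] with [|w| = L j + c], so that [j] fixes the length of the input. About
    [(1 + L) j] bits then yield [n = K j + i] digits of [T], and [L], [K] are chosen to make
    [(1 + L)/K] at most [T + eps]. The residue [i < K] and the correction [a < 4] are built into the
    machine; finitely many machines share one additive constant.

    Real powers are compared by integer arithmetic: temperatures are fractions [P/Q], and
    [a <= N 2^(-lQ/P)] becomes [a^P 2^(lQ) <= N^P].

    The strict inequalities that are searched for hold because the sum really increases with the
    temperature, and for this some compressible string must exist; optimality of [V] supplies one. A
    single such string bounds from below the slope of every stage that contains it. *)

Lemma mrec_nested_ind (P : mrec -> Prop) :
  P MZero -> P MSucc -> (forall i, P (MProj i)) ->
  (forall f gs, P f -> List.Forall P gs -> P (MComp f gs)) ->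
  (forall f g, P f -> P g -> P (MPrec f g)) ->
  (forall f, P f -> P (MMu f)) -> forall e, P e.
Proof.
  intros H0 H1 H2 H3 H4 H5. fix IH 1. intros [| |i|f gs|f g|f];
    [exact H0|exact H1|apply H2| |apply H4; apply IH|apply H5, IH].
  apply H3; [apply IH|]. induction gs as [|g gs IHgs]; constructor; [apply IH|exact IHgs].
Qed.

(** Besides sums, this expresses bounded quantifiers (the sum vanishes or not) and bounded search
    (the sum has one nonzero term), so a single closure lemma for recursive functions covers all
    three. *)
Fixpoint bsum (n : nat) (f : nat -> nat) : nat :=
  match n with 0 => 0 | S m => bsum m f + f m end.

Lemma bsum_ext n f g : (forall i, i < n -> f i = g i) -> bsum n f = bsum n g.
Proof.
  induction n as [|n IH]; simpl; intros H; auto. rewrite IH, H; auto.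
Qed.

Lemma bsum_zero n f : bsum n f = 0 <-> forall i, i < n -> f i = 0.
Proof.
  induction n as [|n IH]; simpl; [split; auto; lia|].
  rewrite Nat.eq_add_0, IH. split.
  - intros [H1 H2] i Hi. destruct (Nat.eq_dec i n) as [->|]; auto. apply H1; lia.
  - intros H. split; auto.
Qed.

Lemma bsum_single n f i :
  i < n -> (forall j, j < n -> j <> i -> f j = 0) -> bsum n f = f i.
Proof.
  induction n as [|n IH]; simpl; intros Hi H; [lia|].
  destruct (Nat.eq_dec i n) as [->|Hne].
  - rewrite (proj2 (bsum_zero n f)); auto. intros; apply H; lia.
  - rewrite IH, (H n); auto; lia.
Qed.

(* [bounded_eval e k v] is [S y] if [e] yields [y] on [v] with all unbounded searches
   cut off at [k], and [0] if no value is found. *)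
Fixpoint bounded_eval (e : mrec) (k : nat) (v : list nat) {struct e} : nat :=
  match e with
  | MZero => 1
  | MSucc => match v with [] => 0 | x :: _ => S (S x) end
  | MProj i => if i <? length v then S (nth i v 0) else 0
  | MComp f gs =>
      if forallb (fun g => 0 <? bounded_eval g k v) gs
      then bounded_eval f k (map (fun g => pred (bounded_eval g k v)) gs) else 0
  | MPrec f g =>
      match v with
      | [] => 0
      | n :: v' =>
          nat_rect (fun _ => nat) (bounded_eval f k v')
            (fun m z => if 0 <? z then bounded_eval g k (m :: pred z :: v') else 0) n
      end
  | MMu f =>
      bsum k (fun n =>
        if (bounded_eval f k (n :: v) =? 1) &&
           (bsum n (fun m => Nat.b2n (bounded_eval f k (m :: v) <=? 1)) =? 0)
        then S n else 0)
  end.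

Lemma bsum_pos n f : 0 < bsum n f -> exists i, i < n /\ 0 < f i.
Proof.
  induction n as [|n IH]; simpl; intros H; [lia|].
  destruct (f n) as [|m] eqn:E; [destruct IH as [i [? ?]]; [lia|exists i; lia]|].
  exists n; lia.
Qed.

(** Values of [bounded_eval] are shifted by one: [1] means that the value 0 was found, and [1 <]
    that a nonzero value was found. *)
Definition mu_found f k v n :=
  bounded_eval f k (n :: v) = 1 /\ forall m, m < n -> 1 < bounded_eval f k (m :: v).

Lemma mu_test f k v n :
  (bounded_eval f k (n :: v) =? 1) &&
  (bsum n (fun m => Nat.b2n (bounded_eval f k (m :: v) <=? 1)) =? 0) = true
  <-> mu_found f k v n.
Proof.
  unfold mu_found. rewrite Bool.andb_true_iff, !Nat.eqb_eq, bsum_zero.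
  split; intros [H1 H2]; split; auto; intros m Hm; specialize (H2 m Hm).
  - destruct (Nat.leb_spec (bounded_eval f k (m :: v)) 1); simpl in *; lia.
  - destruct (Nat.leb_spec (bounded_eval f k (m :: v)) 1); simpl in *; lia.
Qed.

Lemma mu_found_unique f k v n m : mu_found f k v n -> mu_found f k v m -> n = m.
Proof.
  intros [H1 H2] [H3 H4].
  destruct (lt_eq_lt_dec n m) as [[H|H]|H]; auto.
  - specialize (H4 n H); lia.
  - specialize (H2 m H); lia.
Qed.

(** At most one [n] passes the test, so the sum over [n < k] has at most one nonzero term and
    returns the result of the search. *)
Lemma bounded_eval_mu f k v y :
  bounded_eval (MMu f) k v = S y <-> y < k /\ mu_found f k v y.
Proof.
  assert (U : forall n, n < k -> mu_found f k v n -> bounded_eval (MMu f) k v = S n).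
  { intros n Hn H. simpl. rewrite bsum_single with (i := n); auto.
    - rewrite (proj2 (mu_test f k v n) H); auto.
    - intros j Hj Hne. destruct (_ && _) eqn:E; auto.
      apply mu_test in E. exfalso; apply Hne; eapply mu_found_unique; eauto. }
  split; [|intros []; auto].
  intros H. assert (H' : 0 < bounded_eval (MMu f) k v) by lia. simpl in H'.
  apply bsum_pos in H'. destruct H' as [n [Hn H']].
  destruct (_ && _) eqn:E in H'; [|lia].
  apply mu_test in E. rewrite (U n Hn E) in H. injection H as ->. auto.
Qed.

Lemma bounded_eval_sound e : forall k v y, bounded_eval e k v = S y -> eval e v y.
Proof.
  induction e as [| |i|f gs IHf IHgs|f g IHf IHg|f IHf] using mrec_nested_ind;
    intros k v y H.
  - simpl in H. injection H as <-. constructor.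
  - simpl in H. destruct v; [lia|]. injection H as <-. constructor.
  - simpl in H. destruct (Nat.ltb_spec i (length v)); [|lia].
    injection H as <-. constructor; auto.
  - simpl in H. destruct (forallb _ gs) eqn:E; [|lia].
    apply ev_comp with (ws := map (fun g => pred (bounded_eval g k v)) gs).
    + clear H IHf. induction gs as [|g gs IH]; simpl; constructor.
      * inversion IHgs; subst. simpl in E. apply andb_prop in E as [E _].
        apply Nat.ltb_lt in E. apply (H1 k). lia.
      * inversion IHgs; subst. simpl in E. apply andb_prop in E as [_ E]. auto.
    + eapply IHf; eauto.
  - destruct v as [|n v]; simpl in H; [lia|].
    revert y H. induction n as [|n IHn]; simpl; intros y H.
    + constructor. eapply IHf; eauto.
    + destruct (nat_rect _ _ _ n) as [|z] eqn:E; simpl in H; [lia|].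
      econstructor; [apply IHn; reflexivity|]. eapply IHg; eauto.
  - apply bounded_eval_mu in H as [Hy [H1 H2]]. constructor.
    + eapply IHf; eauto.
    + intros m Hm. specialize (H2 m Hm).
      exists (pred (pred (bounded_eval f k (m :: v)))). apply (IHf k). lia.
Qed.

(** Thresholds of finitely many conditions are merged into one. This serves bounded searches, finite
    sets of strings, and finite families of machines. *)
Lemma eventually_forall_lt (P : nat -> nat -> Prop) n :
  (forall m, m < n -> exists k0, forall k, k0 <= k -> P m k) ->
  exists k0, forall m, m < n -> forall k, k0 <= k -> P m k.
Proof.
  induction n as [|n IH]; intros H; [exists 0; lia|].
  destruct IH as [k1 H1]; [auto|]. destruct (H n) as [k2 H2]; [lia|].
  exists (k1 + k2). intros m Hm k Hk.
  destruct (Nat.eq_dec m n) as [->|]; [apply H2|apply H1]; lia.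
Qed.

(** Success is claimed for all large [k], so the thresholds of subcomputations combine by
    addition. *)
Lemma bounded_eval_complete e :
  forall v y, eval e v y -> exists k0, forall k, k0 <= k -> bounded_eval e k v = S y.
Proof.
  induction e as [| |i|f gs IHf IHgs|f g IHf IHg|f IHf] using mrec_nested_ind;
    intros v y H.
  - inversion H; subst. exists 0; auto.
  - inversion H; subst. exists 0; auto.
  - inversion H; subst. exists 0. intros. simpl.
    destruct (Nat.ltb_spec i (length v)); auto; lia.
  - inversion H as [| | |? ? ? ws ? Hws Hf| | |]; subst.
    destruct (IHf _ _ Hf) as [k1 E1].
    assert (E2 : exists k0, forall k, k0 <= k ->
      forallb (fun g => 0 <? bounded_eval g k v) gs = true /\
      map (fun g => pred (bounded_eval g k v)) gs = ws).
    { clear - Hws IHgs. revert ws Hws. induction gs as [|g gs IH]; intros ws H.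
      - inversion H; subst. exists 0; auto.
      - inversion H as [|? ? ? y' ws' Ha Hb]; subst.
        inversion IHgs as [|? ? Hg Hgs]; subst.
        destruct (Hg _ _ Ha) as [k1 E1]. destruct (IH Hgs _ Hb) as [k2 E2].
        exists (k1 + k2). intros k Hk. simpl. rewrite E1 by lia.
        destruct (E2 k) as [-> ->]; [lia|]. auto. }
    destruct E2 as [k2 E2]. exists (k1 + k2). intros k Hk. simpl.
    destruct (E2 k) as [-> ->]; [lia|]. apply E1; lia.
  - destruct v as [|n v]; [inversion H|]. revert y H.
    induction n as [|n IHn]; intros y H;
      inversion H as [| | | |? ? ? ? Hf|? ? ? ? z ? Hz Hg|]; subst.
    + destruct (IHf _ _ Hf) as [k0 E0]. exists k0. intros. simpl; auto.
    + destruct (IHn _ Hz) as [k1 E1]. destruct (IHg _ _ Hg) as [k2 E2].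
      exists (k1 + k2). intros k Hk. specialize (E1 k). simpl in *.
      rewrite E1 by lia. simpl. apply E2; lia.
  - inversion H as [| | | | | |? ? ? Hf Hlt]; subst.
    destruct (IHf _ _ Hf) as [k1 E1].
    destruct (eventually_forall_lt (fun m k => 1 < bounded_eval f k (m :: v)) y) as [k2 E2].
    { intros m Hm. destruct (Hlt m Hm) as [x Hx].
      destruct (IHf _ _ Hx) as [k0 E0]. exists k0. intros k Hk.
      rewrite E0 by auto. lia. }
    exists (k1 + k2 + S y). intros k Hk. apply bounded_eval_mu. split; [lia|].
    split; [apply E1; lia|]. intros m Hm; apply E2; lia.
Qed.

(** Both values are computed by the function [bounded_eval] at one common large bound. *)
Lemma eval_fun e v y z : eval e v y -> eval e v z -> y = z.
Proof.
  intros Hy Hz. apply bounded_eval_complete in Hy as [k1 H1].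
  apply bounded_eval_complete in Hz as [k2 H2].
  specialize (H1 (k1 + k2)). specialize (H2 (k1 + k2)).
  rewrite H1 in H2 by lia. specialize (H2 ltac:(lia)). congruence.
Qed.

(** * Closure properties of total recursive functions *)

Definition rec (n : nat) (f : list nat -> nat) : Prop :=
  exists e, forall v, length v = n -> eval e v (f v).

(** As in [rec], only lists of length [n] matter, so [hd 0] and [tl] can play the role of
    projections whatever they return on the empty list. *)
Definition recs (n m : nat) (h : list nat -> list nat) : Prop :=
  exists es, forall v, length v = n -> length (h v) = m /\ evals es v (h v).

Lemma recs_nil n : recs n 0 (fun _ => []).
Proof. exists []. intros. split; auto. constructor. Qed.

Lemma recs_cons n m a h :
  rec n a -> recs n m h -> recs n (S m) (fun v => a v :: h v).
Proof.
  intros [e He] [es Hes]. exists (e :: es). intros v Hv.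
  destruct (Hes v Hv). split; [simpl; auto|]. constructor; auto.
Qed.

Lemma recs_tl n m h : recs n (S m) h -> recs n m (fun v => tl (h v)).
Proof.
  intros [es H]. exists (tl es). intros v Hv. destruct (H v Hv) as [H1 H2].
  destruct (h v); [simpl in H1; lia|]. inversion H2; subst. simpl in *. auto.
Qed.

Lemma recs_id n : recs n n (fun v => v).
Proof.
  exists (map MProj (seq 0 n)). intros v <-. split; auto.
  (* The block of projections starts at an arbitrary [j] so that induction on its length [l]
     applies; the second alternative covers blocks running past the end of [v]. *)
  enough (H : forall l j, evals (map MProj (seq j l)) v (map (fun i => nth i v 0) (seq j l))
     \/ length v < j + l).
  { destruct (H (length v) 0) as [E|]; [|lia].
    replace v with (map (fun i => nth i v 0) (seq 0 (length v))) at 3; auto.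
    apply nth_ext with (d := 0) (d' := 0); [rewrite length_map, length_seq; auto|].
    intros i Hi. rewrite length_map, length_seq in Hi.
    rewrite nth_indep with (d' := nth 0 v 0) by (rewrite length_map, length_seq; auto).
    change (nth 0 v 0) with ((fun i => nth i v 0) 0).
    rewrite map_nth, seq_nth; auto. }
  induction l as [|l IH]; intros j; simpl; [left; constructor|].
  destruct (IH (S j)) as [E|]; [|right; lia].
  destruct (Nat.lt_ge_cases j (length v)); [|right; lia].
  left. constructor; auto. constructor; auto.
Qed.

Lemma rec_subst n m f h : rec m f -> recs n m h -> rec n (fun v => f (h v)).
Proof.
  intros [e He] [es Hes]. exists (MComp e es). intros v Hv.
  destruct (Hes v Hv). econstructor; eauto.
Qed.

Lemma rec_ext n f g : (forall v, length v = n -> g v = f v) -> rec n f -> rec n g.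
Proof. intros H [e He]. exists e. intros. rewrite H; auto. Qed.

Lemma rec_hd n m h : recs n (S m) h -> rec n (fun v => hd 0 (h v)).
Proof.
  apply (rec_subst _ _ (fun v => hd 0 v)). exists (MProj 0).
  intros [|x v] H; simpl in H; [lia|]. apply (ev_proj 0 (x :: v)). simpl; lia.
Qed.

Lemma rec_const n c : rec n (fun _ => c).
Proof.
  induction c as [|c [e He]]; [exists MZero; intros; constructor|].
  exists (MComp MSucc [e]). intros v Hv.
  apply ev_comp with [c]; [|constructor]. constructor; [auto|constructor].
Qed.

Lemma rec_S n a : rec n a -> rec n (fun v => S (a v)).
Proof.
  intros H. apply (rec_subst n 1 (fun v => S (hd 0 v)) (fun v => [a v])).
  - exists MSucc. intros [|x v] Hv; simpl in Hv; [lia|]. constructor.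
  - apply recs_cons; [auto|apply recs_nil].
Qed.

Lemma rec_nat_rect n B F G :
  rec n B -> rec n F ->
  rec (S (S n)) (fun u => G (hd 0 u) (hd 0 (tl u)) (tl (tl u))) ->
  rec n (fun v => nat_rect (fun _ => nat) (F v) (fun m z => G m z v) (B v)).
Proof.
  intros HB [f Hf] [g Hg].
  apply (rec_subst n (S n)
    (fun w => nat_rect (fun _ => nat) (F (tl w)) (fun m z => G m z (tl w)) (hd 0 w))
    (fun v => B v :: v)).
  - exists (MPrec f g). intros [|x v] Hv; simpl in Hv; [lia|]. injection Hv as Hv. simpl.
    induction x as [|x IH]; simpl; [constructor; auto|].
    econstructor; [exact IH|]. apply (Hg (x :: _ :: v)). simpl; auto.
  - apply recs_cons; [auto|apply recs_id].
Qed.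

Ltac rec_list :=
  first [apply recs_id | apply recs_tl; rec_list | apply recs_nil
        | apply recs_cons; [eapply rec_hd; rec_list | rec_list]].

Ltac rec_var := eapply rec_hd; rec_list.

Ltac rec_weaken :=
  match goal with H : rec _ ?f |- rec _ (fun u => ?f _) =>
    eapply (rec_subst _ _ f); [exact H | rec_list] end.

Lemma rec_add n a b : rec n a -> rec n b -> rec n (fun v => a v + b v).
Proof.
  intros Ha Hb.
  apply rec_ext with (fun v => nat_rect (fun _ => nat) (b v) (fun _ z => S z) (a v)).
  { intros v _. induction (a v); simpl; auto. }
  apply (rec_nat_rect n a b (fun _ z _ => S z)); auto. apply rec_S. rec_var.
Qed.

Lemma rec_mul n a b : rec n a -> rec n b -> rec n (fun v => a v * b v).
Proof.
  intros Ha Hb.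
  apply rec_ext with (fun v => nat_rect (fun _ => nat) 0 (fun _ z => b v + z) (a v)).
  { intros v _. induction (a v); simpl; auto. }
  apply (rec_nat_rect n a _ (fun _ z v => b v + z)); auto; [apply rec_const|].
  apply rec_add; [rec_weaken|rec_var].
Qed.

Lemma rec_pow n a b : rec n a -> rec n b -> rec n (fun v => a v ^ b v).
Proof.
  intros Ha Hb.
  apply rec_ext with (fun v => nat_rect (fun _ => nat) 1 (fun _ z => a v * z) (b v)).
  { intros v _. induction (b v); simpl; auto. }
  apply (rec_nat_rect n b _ (fun _ z v => a v * z)); auto; [apply rec_const|].
  apply rec_mul; [rec_weaken|rec_var].
Qed.

Lemma rec_pred n a : rec n a -> rec n (fun v => pred (a v)).
Proof.
  intros Ha.
  apply rec_ext with (fun v => nat_rect (fun _ => nat) 0 (fun m _ => m) (a v)).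
  { intros v _. destruct (a v); auto. }
  apply (rec_nat_rect n a _ (fun m _ _ => m)); auto; [apply rec_const|rec_var].
Qed.

Lemma rec_sub n a b : rec n a -> rec n b -> rec n (fun v => a v - b v).
Proof.
  intros Ha Hb.
  apply rec_ext with (fun v => nat_rect (fun _ => nat) (a v) (fun _ z => pred z) (b v)).
  { intros v _. induction (b v); simpl; lia. }
  apply (rec_nat_rect n b _ (fun _ z _ => pred z)); auto. apply rec_pred. rec_var.
Qed.

Lemma rec_bsum n B F :
  rec n B -> rec (S n) (fun u => F (hd 0 u) (tl u)) ->
  rec n (fun v => bsum (B v) (fun i => F i v)).
Proof.
  intros HB HF.
  apply rec_ext with
    (fun v => nat_rect (fun _ => nat) 0 (fun m z => z + F m v) (B v)).
  { intros v _. induction (B v); simpl; auto. }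
  apply (rec_nat_rect n B _ (fun m z v => z + F m v)); auto; [apply rec_const|].
  apply rec_add; [rec_var|].
  apply (rec_subst _ _ _ (fun u => hd 0 u :: tl (tl u)) HF). rec_list.
Qed.

Definition recb (n : nat) (c : list nat -> bool) : Prop :=
  rec n (fun v => Nat.b2n (c v)).

Lemma recb_leb n a b : rec n a -> rec n b -> recb n (fun v => a v <=? b v).
Proof.
  intros Ha Hb. apply rec_ext with (fun v => 1 - (a v - b v)).
  { intros v _. destruct (Nat.leb_spec (a v) (b v)); unfold Nat.b2n; lia. }
  repeat apply rec_sub; auto. apply rec_const.
Qed.

Lemma recb_ltb n a b : rec n a -> rec n b -> recb n (fun v => a v <? b v).
Proof. intros Ha Hb. apply recb_leb; auto. apply rec_S; auto. Qed.

Lemma recb_andb n c d : recb n c -> recb n d -> recb n (fun v => c v && d v).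
Proof.
  intros Hc Hd. apply rec_ext with (fun v => Nat.b2n (c v) * Nat.b2n (d v)).
  { intros v _. destruct (c v), (d v); auto. }
  apply rec_mul; auto.
Qed.

Lemma recb_negb n c : recb n c -> recb n (fun v => negb (c v)).
Proof.
  intros Hc. apply rec_ext with (fun v => 1 - Nat.b2n (c v)).
  { intros v _. destruct (c v); auto. }
  apply rec_sub; auto. apply rec_const.
Qed.

Lemma recb_eqb n a b : rec n a -> rec n b -> recb n (fun v => a v =? b v).
Proof.
  intros Ha Hb.
  apply rec_ext with (fun v => Nat.b2n ((a v <=? b v) && (b v <=? a v))).
  { intros v _. f_equal. destruct (Nat.eqb_spec (a v) (b v)),
      (Nat.leb_spec (a v) (b v)), (Nat.leb_spec (b v) (a v)); auto; lia. }
  apply recb_andb; apply recb_leb; auto.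
Qed.

Lemma rec_if n c a b :
  recb n c -> rec n a -> rec n b -> rec n (fun v => if c v then a v else b v).
Proof.
  intros Hc Ha Hb.
  apply rec_ext with (fun v => Nat.b2n (c v) * a v + (1 - Nat.b2n (c v)) * b v).
  { intros v _. destruct (c v); simpl; lia. }
  apply rec_add; apply rec_mul; auto. apply rec_sub; auto. apply rec_const.
Qed.

Definition bex (n : nat) (c : nat -> bool) : bool := 0 <? bsum n (fun i => Nat.b2n (c i)).

Lemma bex_iff n c : bex n c = true <-> exists i, i < n /\ c i = true.
Proof.
  unfold bex. rewrite Nat.ltb_lt. split.
  - intros H. apply bsum_pos in H as [i [Hi H]]. exists i.
    destruct (c i); auto. simpl in H; lia.
  - intros [i [Hi H]]. destruct (Nat.eq_0_gt_0_cases (bsum n (fun i => Nat.b2n (c i)))); auto.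
    rewrite bsum_zero in H0. specialize (H0 i Hi). rewrite H in H0. discriminate.
Qed.

Lemma recb_bex n B c :
  rec n B -> recb (S n) (fun u => c (hd 0 u) (tl u)) ->
  recb n (fun v => bex (B v) (fun i => c i v)).
Proof.
  intros HB HF. apply recb_ltb; [apply rec_const|].
  apply (rec_bsum n B (fun i v => Nat.b2n (c i v))); auto.
Qed.

(** A hook for [rec_solve], redefined once pairing, length and parity are known to be recursive. *)
Ltac rec_user := fail.

Ltac rec_solve := cbv beta; lazymatch goal with
  | |- rec _ (fun _ => ?c) => apply rec_const
  | |- rec _ (fun v => hd 0 (@?h v)) => rec_var
  | |- rec _ (hd 0) => rec_var
  | |- rec _ (fun v => S (@?a v)) => apply rec_S; rec_solve
  | |- rec _ (fun v => pred (@?a v)) => apply rec_pred; rec_solve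
  | |- rec _ (fun v => @?a v + @?b v) => apply rec_add; rec_solve
  | |- rec _ (fun v => @?a v * @?b v) => apply rec_mul; rec_solve
  | |- rec _ (fun v => @?a v - @?b v) => apply rec_sub; rec_solve
  | |- rec _ (fun v => @?a v ^ @?b v) => apply rec_pow; rec_solve
  | |- rec _ (fun v => if @?c v then @?a v else @?b v) => apply rec_if; rec_solve
  | |- rec ?n (fun v => bsum (@?B v) (fun i => @?F v i)) =>
      apply (rec_bsum n B (fun i v => F v i)); rec_solve
  | |- rec ?n (fun v => Nat.b2n (@?c v)) => change (recb n c); rec_solve
  | |- recb _ (fun v => @?a v <=? @?b v) => apply recb_leb; rec_solve
  | |- recb _ (fun v => @?a v <? @?b v) => apply recb_ltb; rec_solve
  | |- recb _ (fun v => @?a v =? @?b v) => apply recb_eqb; rec_solve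
  | |- recb _ (fun v => @?a v && @?b v) => apply recb_andb; rec_solve
  | |- recb _ (fun v => negb (@?a v)) => apply recb_negb; rec_solve
  | |- recb ?n (fun v => bex (@?B v) (fun i => @?F v i)) =>
      apply (recb_bex n B (fun i v => F v i)); rec_solve
  | |- _ => first [assumption | rec_weaken | rec_user; rec_solve]
  end.

(** The bound is an argument of the function while the term [e] is fixed, so structural induction on
    [e] builds the required program. This makes the enumeration of the compressible strings
    recursive. *)
Lemma rec_bounded_eval e : forall n, rec (S n) (fun w => bounded_eval e (hd 0 w) (tl w)).
Proof.
  induction e as [| |i|f gs IHf IHgs|f g IHf IHg|f IHf] using mrec_nested_ind; intros n.
  - apply (rec_const _ 1).
  - destruct n as [|n].
    + apply rec_ext with (fun _ => 0); [|apply rec_const].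
      intros [|k [|x v]] Hv; simpl in *; auto; lia.
    + apply rec_ext with (fun w => S (S (hd 0 (tl w)))); [|rec_solve].
      intros [|k [|x v]] Hv; simpl in *; auto; lia.
  - destruct (Nat.ltb_spec i n) as [Hi|Hi].
    (* Generalised to the entry [i] after [j] tails: the induction on [i] turns one unit of [i] into
       one more tail. *)
    + assert (H : forall j m, j + S i <= m ->
        rec m (fun w => nth i (Nat.iter j (@tl nat) w) 0)).
      { clear. induction i as [|i IH]; intros j m H.
        - apply rec_ext with (fun w => hd 0 (Nat.iter j (@tl nat) w)).
          { intros w _. destruct (Nat.iter j (@tl nat) w); auto. }
          eapply rec_hd with (m := m - S j).
          replace m with (m - j + j) at 1 by lia.
          replace (S (m - S j)) with (m - j) by lia.
          generalize (m - j). clear. intros l.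
          revert l. induction j as [|j IH]; intros l; simpl.
          + rewrite Nat.add_0_r. apply recs_id.
          + apply recs_tl. replace (l + S j) with (S l + j) by lia. apply IH.
        - apply rec_ext with (fun w => nth i (Nat.iter (S j) (@tl nat) w) 0).
          { intros w _. simpl. destruct (Nat.iter j (@tl nat) w); simpl; destruct i; auto. }
          apply IH. lia. }
      apply rec_ext with (fun w => S (nth i (tl w) 0)).
      { intros [|k w] Hw; simpl in *; [lia|].
        destruct (Nat.ltb_spec i (length w)); auto; lia. }
      apply rec_S. apply (H 1 (S n)). lia.
    + apply rec_ext with (fun _ => 0); [|apply rec_const].
      intros [|k w] Hw; simpl in *; [lia|].
      destruct (Nat.ltb_spec i (length w)); auto; lia.
  - simpl. apply rec_if; [| |apply rec_const].
    + induction IHgs as [|g gs Hg Hgs IH]; simpl; [apply (rec_const _ 1)|].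
      apply recb_andb; auto. apply recb_ltb; [apply rec_const|auto].
    + apply (rec_subst (S n) (S (length gs)) _
        (fun w => hd 0 w :: map (fun g => pred (bounded_eval g (hd 0 w) (tl w))) gs) (IHf _)).
      apply recs_cons; [rec_var|].
      induction IHgs as [|g gs Hg Hgs IH]; simpl; [apply recs_nil|].
      apply recs_cons; auto. apply rec_pred; auto.
  - destruct n as [|n].
    { apply rec_ext with (fun _ => 0); [|apply rec_const].
      intros [|k [|x v]] Hv; simpl in *; auto; lia. }
    apply rec_ext with (fun w =>
      nat_rect (fun _ => nat) (bounded_eval f (hd 0 w) (tl (tl w)))
        (fun m z => if 0 <? z then bounded_eval g (hd 0 w) (m :: pred z :: tl (tl w)) else 0)
        (hd 0 (tl w))).
    { intros [|k [|x v]] Hv; simpl in *; auto; lia. }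
    apply (rec_nat_rect _ _ _ (fun m z w =>
      if 0 <? z then bounded_eval g (hd 0 w) (m :: pred z :: tl (tl w)) else 0)); [rec_var| |].
    + apply (rec_subst _ (S n) _ (fun w => hd 0 w :: tl (tl w)) (IHf _)). rec_list.
    + apply rec_if; [rec_solve| |apply rec_const].
      apply (rec_subst _ (S (S (S n))) _ (fun u => hd 0 (tl (tl u)) :: hd 0 u ::
        pred (hd 0 (tl u)) :: tl (tl (tl (tl u)))) (IHg _)).
      do 2 (apply recs_cons; [rec_var|]). apply recs_cons; [rec_solve|rec_list].
  - simpl.
    assert (Hf : rec (S (S n)) (fun u => bounded_eval f (hd 0 (tl u)) (hd 0 u :: tl (tl u)))).
    { apply (rec_subst _ (S (S n)) _ (fun u => hd 0 (tl u) :: hd 0 u :: tl (tl u))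
        (IHf _)). rec_list. }
    apply (rec_bsum _ _ (fun i w =>
      if (bounded_eval f (hd 0 w) (i :: tl w) =? 1) &&
         (bsum i (fun m => Nat.b2n (bounded_eval f (hd 0 w) (m :: tl w) <=? 1)) =? 0)
      then S i else 0)); [rec_var|].
    apply rec_if; [|rec_solve|rec_solve].
    apply recb_andb; [apply recb_eqb; [exact Hf|rec_solve]|].
    apply recb_eqb; [|rec_solve].
    apply (rec_bsum _ _ (fun m u =>
      Nat.b2n (bounded_eval f (hd 0 (tl u)) (m :: tl (tl u)) <=? 1))); [rec_var|].
    apply recb_leb; [|rec_solve].
    apply (rec_subst _ (S (S n)) _ (fun u => hd 0 u :: tl (tl u)) Hf). rec_list.
Qed.

(** * Unbounded search, pairing, and codes of strings *)

Definition rec1 (f : nat -> nat) : Prop := rec 1 (fun v => f (hd 0 v)).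

Definition rec2 (f : nat -> nat -> nat) : Prop :=
  rec 2 (fun v => f (hd 0 v) (hd 0 (tl v))).

Lemma rec1_app f n a : rec1 f -> rec n a -> rec n (fun v => f (a v)).
Proof.
  intros Hf Ha. apply (rec_subst n 1 _ (fun v => [a v]) Hf).
  apply recs_cons; [auto|apply recs_nil].
Qed.

Lemma rec2_app f n a b :
  rec2 f -> rec n a -> rec n b -> rec n (fun v => f (a v) (b v)).
Proof.
  intros Hf Ha Hb. apply (rec_subst n 2 _ (fun v => [a v; b v]) Hf).
  apply recs_cons; auto. apply recs_cons; [auto|apply recs_nil].
Qed.

Definition least (c : nat -> bool) (z : nat) : Prop :=
  c z = true /\ forall m, m < z -> c m = false.

Lemma least_exists c : (exists z, c z = true) -> exists z, least c z.
Proof.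
  intros [z0 Hz0].
  destruct (dec_inh_nat_subset_has_unique_least_element (fun z => c z = true))
    as [z [[Hz Hmin] _]].
  - intros z. destruct (c z); auto.
  - eauto.
  - exists z. split; auto. intros m Hm. destruct (c m) eqn:Em; auto.
    specialize (Hmin m Em). lia.
Qed.

(** The equivalence also describes where the machine diverges, which is what proofs of
    prefix-freeness rely on. *)
Lemma search_machine (D : nat -> nat -> bool) (O : nat -> nat -> nat) :
  recb 2 (fun v => D (hd 0 v) (hd 0 (tl v))) -> rec2 O ->
  exists e, forall y x, eval e [y] x <-> exists z, least (D y) z /\ x = O y z.
Proof.
  intros HD [o Ho].
  assert (Hf : rec 2 (fun v => 1 - Nat.b2n (D (hd 0 (tl v)) (hd 0 v)))).
  { apply rec_sub; [apply rec_const|].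
    apply (rec_subst 2 2 _ (fun v => [hd 0 (tl v); hd 0 v]) HD). rec_list. }
  destruct Hf as [f Hf].
  assert (E : forall y z, least (D y) z -> eval (MMu f) [y] z).
  { intros y z [Hz Hmin]. constructor.
    - pose proof (Hf [z; y] eq_refl) as E. simpl in E. rewrite Hz in E. exact E.
    - intros m Hm. exists 0. pose proof (Hf [m; y] eq_refl) as E. simpl in E.
      rewrite Hmin in E; auto. }
  exists (MComp o [MProj 0; MMu f]). intros y x. split.
  - intros H. inversion H as [| | |? ? ? ws ? Hws Ho'| | |]; subst.
    inversion Hws as [|? ? ? a ws1 Ha Hws1]; subst.
    inversion Hws1 as [|? ? ? z ws2 Hz Hws2]; subst. inversion Hws2; subst.
    inversion Ha; subst. simpl in Ho'. exists z. split.
    (* Convergence of [MMu f] to [z] gives [D y z], hence a least solution exists, and determinism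
       identifies it with [z]. *)
    + destruct (least_exists (D y)) as [z' Hz'].
      * exists z. inversion Hz as [| | | | | |? ? ? Hz0 _]; subst.
        pose proof (eval_fun _ _ _ _ Hz0 (Hf [z; y] eq_refl)) as E0. simpl in E0.
        destruct (D y z); auto; discriminate.
      * rewrite (eval_fun _ _ _ _ Hz (E _ _ Hz')). auto.
    + apply (eval_fun _ _ _ _ Ho' (Ho [y; z] eq_refl)).
  - intros [z [Hz ->]]. apply ev_comp with [y; z].
    + constructor; [apply ev_proj; simpl; lia|]. constructor; [auto|constructor].
    + apply (Ho [y; z] eq_refl).
Qed.

Lemma unpair_cantor m :
  let (x, y) := unpair m in 2 * m = (x + y) * (x + y + 1) + 2 * y.
Proof.
  induction m as [|m IH]; simpl unpair; [reflexivity|].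
  destruct (unpair m) as [[|x] y]; nia.
Qed.

Lemma cantor_inj x y x' y' :
  (x + y) * (x + y + 1) + 2 * y = (x' + y') * (x' + y' + 1) + 2 * y' ->
  x = x' /\ y = y'.
Proof.
  intros H. assert (x + y = x' + y') by nia. split; nia.
Qed.

Definition cfst (m : nat) : nat := fst (unpair m).
Definition csnd (m : nat) : nat := snd (unpair m).

Lemma unpair_surj x y : exists m, cfst m = x /\ csnd m = y.
Proof.
  assert (E : exists h, 2 * h = (x + y) * (x + y + 1)).
  { generalize (x + y). induction n as [|n [h Hh]]; [exists 0; auto|].
    exists (h + S n). lia. }
  destruct E as [h Hh]. exists (h + y). unfold cfst, csnd.
  pose proof (unpair_cantor (h + y)) as H. destruct (unpair (h + y)) as [x' y'].
  apply cantor_inj. simpl. lia.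
Qed.

Definition cantor_code (m x y : nat) : bool :=
  2 * m =? (x + y) * (x + y + 1) + 2 * y.

(** Decoding by exhaustive search: both coordinates are at most [m], and exactly one pair satisfies
    the closed formula for Cantor's pairing. This form is visibly recursive. *)
Lemma unpair_bsum (g : nat -> nat -> nat) m :
  g (cfst m) (csnd m) =
  bsum (S m) (fun x => bsum (S m) (fun y => Nat.b2n (cantor_code m x y) * g x y)).
Proof.
  unfold cfst, csnd, cantor_code. pose proof (unpair_cantor m) as H.
  destruct (unpair m) as [x y]. simpl fst; simpl snd.
  rewrite bsum_single with (i := x).
  - rewrite bsum_single with (i := y); [|nia|].
    + rewrite (proj2 (Nat.eqb_eq _ _) H). simpl; lia.
    + intros j Hj Hne. destruct (Nat.eqb_spec (2 * m) ((x + j) * (x + j + 1) + 2 * j)); auto.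
      exfalso; apply Hne. symmetry. apply (cantor_inj x y x j). lia.
  - nia.
  - intros i Hi Hne. apply bsum_zero. intros j Hj.
    destruct (Nat.eqb_spec (2 * m) ((i + j) * (i + j + 1) + 2 * j)); auto.
    exfalso; apply Hne. symmetry. apply (cantor_inj x y i j). lia.
Qed.

Lemma rec_cfst n a : rec n a -> rec n (fun v => cfst (a v)).
Proof.
  apply (rec1_app cfst).
  eapply rec_ext; [intros v _; apply (unpair_bsum (fun x _ => x))|].
  unfold cantor_code. rec_solve.
Qed.

Lemma rec_csnd n a : rec n a -> rec n (fun v => csnd (a v)).
Proof.
  apply (rec1_app csnd).
  eapply rec_ext; [intros v _; apply (unpair_bsum (fun _ y => y))|].
  unfold cantor_code. rec_solve.
Qed.

(** Length of the string with code [x]: the binary digits of [S x] are a leading 1 followed by that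
    string. *)
Definition len (x : nat) : nat := Nat.log2 (S x).

Lemma len_spec x : 2 ^ len x <= S x < 2 ^ S (len x).
Proof. apply Nat.log2_spec. lia. Qed.

Lemma len_unique x l : 2 ^ l <= S x < 2 ^ S l -> len x = l.
Proof. intros H. apply Nat.log2_unique; auto. lia. Qed.

(** Recovers a number from its threshold test by counting. Logarithms and floors of roots become
    recursive in this way. *)
Lemma bsum_leb n l : l <= n -> bsum n (fun i => Nat.b2n (S i <=? l)) = l.
Proof.
  intros H. replace n with (l + (n - l)) by lia. generalize (n - l). clear.
  intros d. induction d as [|d IH].
  - rewrite Nat.add_0_r. assert (H : forall m, m <= l -> bsum m (fun i => Nat.b2n (S i <=? l)) = m).
    { induction m as [|m IH]; intros Hm; auto. cbn [bsum].
      rewrite IH by lia. destruct (Nat.leb_spec (S m) l); unfold Nat.b2n; lia. }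
    apply H; auto.
  - rewrite Nat.add_succ_r. cbn [bsum]. rewrite IH.
    destruct (Nat.leb_spec (S (l + d)) l); unfold Nat.b2n; lia.
Qed.

Lemma rec_len n a : rec n a -> rec n (fun v => len (a v)).
Proof.
  apply (rec1_app len).
  apply rec_ext with (fun v => bsum (hd 0 v) (fun i => Nat.b2n (2 ^ S i <=? S (hd 0 v)))).
  { intros v _. generalize (hd 0 v). intros x.
    assert (H : len x <= x) by (pose proof (Nat.log2_lt_lin (S x)); unfold len; lia).
    rewrite <- (bsum_leb x (len x) H) at 1. apply bsum_ext. intros i _.
    f_equal. apply Bool.eq_iff_eq_true. rewrite !Nat.leb_le.
    unfold len. symmetry. apply Nat.log2_le_pow2. lia. }
  rec_solve.
Qed.

Lemma recb_even n a : rec n a -> recb n (fun v => Nat.even (a v)).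
Proof.
  apply (rec1_app (fun x => Nat.b2n (Nat.even x))).
  apply rec_ext with (fun v => nat_rect (fun _ => nat) 1 (fun _ z => 1 - z) (hd 0 v)).
  { intros v _. induction (hd 0 v) as [|x IH]; auto.
    rewrite Nat.even_succ, <- Nat.negb_even. cbn [nat_rect]. rewrite <- IH.
    destruct (Nat.even x); auto. }
  apply (rec_nat_rect _ _ _ (fun _ z _ => 1 - z)); rec_solve.
Qed.

Definition val (s : bstring) : nat :=
  fold_left (fun acc (b : bool) => 2 * acc + (if b then 1 else 0)) s 0.

Lemma fold_bits s : forall a,
  fold_left (fun acc (b : bool) => 2 * acc + (if b then 1 else 0)) s a =
  a * 2 ^ length s + val s.
Proof.
  unfold val. induction s as [|b s IH]; intros a; [simpl; lia|].
  cbn [fold_left length]. rewrite IH, (IH (2 * 0 + _)), Nat.pow_succ_r'. nia.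
Qed.

Lemma val_cons b s : val (b :: s) = (if b then 2 ^ length s else 0) + val s.
Proof.
  unfold val at 1. cbn [fold_left]. rewrite fold_bits. destruct b; lia.
Qed.

Lemma val_app s t : val (s ++ t) = val s * 2 ^ length t + val t.
Proof. unfold val at 1. rewrite fold_left_app. apply fold_bits. Qed.

Lemma two_pow_pos n : 0 < 2 ^ n.
Proof. pose proof (Nat.pow_nonzero 2 n). lia. Qed.

Lemma val_lt s : val s < 2 ^ length s.
Proof.
  induction s as [|b s IH]; [unfold val; simpl; lia|].
  rewrite val_cons. simpl length. rewrite Nat.pow_succ_r'. destruct b; lia.
Qed.

Lemma enc_val s : S (enc s) = 2 ^ length s + val s.
Proof.
  unfold enc. rewrite fold_bits. pose proof (two_pow_pos (length s)). lia.
Qed.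

Lemma len_enc s : len (enc s) = length s.
Proof.
  apply len_unique. rewrite enc_val, Nat.pow_succ_r'. pose proof (val_lt s). lia.
Qed.

Lemma val_inj s : forall t, length s = length t -> val s = val t -> s = t.
Proof.
  induction s as [|b s IH]; intros [|c t] Hl Hv; simpl in Hl; auto; try lia.
  injection Hl as Hl. rewrite !val_cons, Hl in Hv.
  pose proof (val_lt s). pose proof (val_lt t). rewrite Hl in H.
  destruct b, c; try lia; f_equal; apply IH; auto; lia.
Qed.

Lemma enc_inj s t : enc s = enc t -> s = t.
Proof.
  intros H. assert (Hl : length s = length t) by (rewrite <- !len_enc; congruence).
  apply val_inj; auto. pose proof (enc_val s). pose proof (enc_val t).
  rewrite Hl in *. lia.
Qed.

Lemma val_surj l : forall w, w < 2 ^ l -> exists s, length s = l /\ val s = w.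
Proof.
  induction l as [|l IH]; intros w Hw; [exists []; simpl in *; unfold val; simpl; split; lia|].
  rewrite Nat.pow_succ_r' in Hw. destruct (Nat.lt_ge_cases w (2 ^ l)) as [H|H].
  - destruct (IH w H) as [s [Hs Hv]]. exists (false :: s). rewrite val_cons. simpl; auto.
  - destruct (IH (w - 2 ^ l)) as [s [Hs Hv]]; [lia|].
    exists (true :: s). rewrite val_cons, Hs. simpl; split; auto. lia.
Qed.

Lemma enc_surj x : exists s, enc s = x.
Proof.
  pose proof (len_spec x) as H. rewrite Nat.pow_succ_r' in H.
  destruct (val_surj (len x) (S x - 2 ^ len x)) as [s [Hs Hv]]; [lia|].
  exists s. pose proof (enc_val s). rewrite Hs in *. lia.
Qed.

Ltac rec_user ::= first
  [apply rec_cfst | apply rec_csnd | apply rec_len | apply recb_even].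

(** * The enumeration of compressible strings *)

Definition compressible (V : mrec) (x : nat) : Prop :=
  exists p, eval V [p] x /\ len p < len x.

(** The number [k] bounds the string, the program and the searches at once, so that each stage is
    finite and decidable. *)
Definition in_stage (V : mrec) (k x : nat) : bool :=
  (x <? k) && bex k (fun p => (bounded_eval V k [p] =? S x) && (len p <? len x)).

Lemma in_stage_sound V k x : in_stage V k x = true -> x < k /\ compressible V x.
Proof.
  unfold in_stage. rewrite Bool.andb_true_iff, Nat.ltb_lt, bex_iff.
  intros [Hx [p [_ H]]]. rewrite Bool.andb_true_iff, Nat.eqb_eq, Nat.ltb_lt in H.
  split; auto. exists p. split; [|tauto]. apply bounded_eval_sound with k. tauto.
Qed.

Lemma in_stage_complete V x :
  compressible V x -> exists k0, forall k, k0 <= k -> in_stage V k x = true.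
Proof.
  intros [p [Hp Hl]]. destruct (bounded_eval_complete _ _ _ Hp) as [k0 H0].
  exists (k0 + S x + S p). intros k Hk. unfold in_stage.
  rewrite Bool.andb_true_iff, Nat.ltb_lt, bex_iff. split; [lia|].
  exists p. split; [lia|]. rewrite Bool.andb_true_iff, Nat.eqb_eq, Nat.ltb_lt.
  split; auto. apply H0; lia.
Qed.

Lemma recb_in_stage V n a b : rec n a -> rec n b -> recb n (fun v => in_stage V (a v) (b v)).
Proof.
  intros Ha Hb.
  apply (rec2_app (fun k x => Nat.b2n (in_stage V k x))); auto.
  unfold rec2, in_stage.
  assert (H : rec 3 (fun u => bounded_eval V (hd 0 (tl u)) [hd 0 u])).
  { apply (rec_subst 3 2 _ (fun u => [hd 0 (tl u); hd 0 u]) (rec_bounded_eval V 1)). rec_list. }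
  rec_solve.
Qed.

Lemma compressible_enc V s : compressible V (enc s) <-> exists p, run V p s /\ length p < length s.
Proof.
  unfold compressible, run. split.
  - intros [x [H Hl]]. destruct (enc_surj x) as [p <-].
    rewrite !len_enc in Hl. eauto.
  - intros [p [H Hl]]. exists (enc p). rewrite !len_enc. auto.
Qed.

Definition shortest U s k :=
  (exists p, run U p s /\ length p = k) /\ forall p, run U p s -> k <= length p.

(** Eliminates the choice operator in [HC]: the lengths of the programs for [s], if there are any,
    have a least element. *)
Lemma HC_cases U s :
  ((forall p, ~ run U p s) /\ HC U s = p_infty) \/
  (exists k, shortest U s k /\ HC U s = Finite (INR k)).
Proof.
  unfold HC. destruct (excluded_middle_informative _) as [[p Hp]|H].
  - right. eexists. split; [|reflexivity]. apply epsilon_spec.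
    destruct (dec_inh_nat_subset_has_unique_least_element
      (fun k => exists p, run U p s /\ length p = k)) as [k [[Hk Hmin] _]].
    { intros. apply classic. }
    { eauto. }
    exists k. split; auto. intros q Hq. apply Hmin; eauto.
  - left. split; auto. intros p Hp. apply H; eauto.
Qed.

Open Scope R_scope.

Lemma HC_le U p s : run U p s -> Rbar_le (HC U s) (Finite (INR (length p))).
Proof.
  intros H. destruct (HC_cases U s) as [[Hn _]|[k [[_ Hk] ->]]].
  - destruct (Hn p H).
  - simpl. apply le_INR. auto.
Qed.

Lemma HC_ge U s r :
  (forall p, run U p s -> r <= INR (length p)) -> Rbar_le (Finite r) (HC U s).
Proof.
  intros H. destruct (HC_cases U s) as [[_ ->]|[k [[[p [Hp <-]] _] ->]]]; simpl; auto.
Qed.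

Lemma HC_lt_iff V s : Rbar_lt (HC V s) (Finite (INR (length s))) <-> compressible V (enc s).
Proof.
  rewrite compressible_enc. destruct (HC_cases V s) as [[Hn ->]|[k [[[p [Hp <-]] Hmin] ->]]]; simpl.
  - split; [tauto|]. intros [p [Hp _]]. destruct (Hn p Hp).
  - split.
    + intros H. exists p. split; auto. apply INR_lt; auto.
    + intros [q [Hq Hl]]. apply lt_INR. specialize (Hmin q Hq). lia.
Qed.

(** * Finite sums of reals *)

Fixpoint rsum (n : nat) (f : nat -> R) : R :=
  match n with O => 0 | S m => rsum m f + f m end.

Lemma rsum_le n f g : (forall i, (i < n)%nat -> f i <= g i) -> rsum n f <= rsum n g.
Proof.
  induction n as [|n IH]; intros H; cbn [rsum]; [lra|].
  apply Rplus_le_compat; auto.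
Qed.

Lemma rsum_ext n f g : (forall i, (i < n)%nat -> f i = g i) -> rsum n f = rsum n g.
Proof.
  intros H. apply Rle_antisym; apply rsum_le; intros; rewrite H; auto; lra.
Qed.

Lemma rsum_plus n f g : rsum n (fun i => f i + g i) = rsum n f + rsum n g.
Proof. induction n as [|n IH]; cbn [rsum]; [lra|]. rewrite IH; lra. Qed.

Lemma rsum_scal n c f : rsum n (fun i => c * f i) = c * rsum n f.
Proof. induction n as [|n IH]; cbn [rsum]; [lra|]. rewrite IH; lra. Qed.

Lemma rsum_nonneg n f : (forall i, 0 <= f i) -> 0 <= rsum n f.
Proof.
  intros H. induction n as [|n IH]; cbn [rsum]; [lra|]. specialize (H n); lra.
Qed.

Lemma rsum_extend n m f :
  (n <= m)%nat -> (forall i, (n <= i)%nat -> f i = 0) -> rsum m f = rsum n f.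
Proof.
  intros Hm H. induction Hm as [|m Hm IH]; auto. cbn [rsum]. rewrite IH, H; auto; lra.
Qed.

Lemma rsum_mono n m f : (n <= m)%nat -> (forall i, 0 <= f i) -> rsum n f <= rsum m f.
Proof.
  intros Hm H. induction Hm as [|m Hm IH]; [lra|]. cbn [rsum]. specialize (H m); lra.
Qed.

Lemma rsum_single n f j :
  (j < n)%nat -> (forall i, 0 <= f i) -> f j <= rsum n f.
Proof.
  intros Hj H. pose proof (rsum_mono (S j) n f Hj H). cbn [rsum] in H0.
  pose proof (rsum_nonneg j f H). lra.
Qed.

Lemma rsum_seq a n f :
  rsum (a + n) f = rsum a f + fold_right Rplus 0 (map f (seq a n)).
Proof.
  revert a. induction n as [|n IH]; intros a; [rewrite Nat.add_0_r; simpl; lra|].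
  replace (a + S n)%nat with (S a + n)%nat by lia. rewrite IH. simpl. lra.
Qed.

(** * The weight of a string of length [l] as a function of the temperature *)

Definition pw (l : nat) (t : R) : R := Rpower 2 (- INR l / t).

Lemma pw_pos l t : 0 < pw l t.
Proof. apply exp_pos. Qed.

Lemma ln2_pos : 0 < ln 2.
Proof. rewrite <- ln_1. apply ln_increasing; lra. Qed.

Lemma pw_exp l t : pw l t = exp (- (INR l * ln 2 * / t)).
Proof. unfold pw, Rpower. f_equal. unfold Rdiv. ring. Qed.

Lemma inv_diff s t : 0 < s -> 0 < t -> / s - / t = (t - s) / (s * t).
Proof. intros. field; lra. Qed.

Lemma pw_le l s t : 0 < s <= t -> pw l s <= pw l t.
Proof.
  intros H. rewrite !pw_exp. pose proof (pos_INR l). pose proof ln2_pos.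
  assert (/ t <= / s) by (apply Rinv_le_contravar; lra).
  assert (H3 : INR l * ln 2 * / t <= INR l * ln 2 * / s).
  { apply Rmult_le_compat_l; auto. apply Rmult_le_pos; lra. }
  destruct (Rle_lt_or_eq_dec _ _ H3) as [H4|H4].
  - left. apply exp_increasing. lra.
  - rewrite H4. lra.
Qed.

(* Both slope bounds come from [1 + y <= exp y] with [y = l ln 2 (1/s - 1/t)]. *)
Lemma pw_slope_low l s t : 0 < s <= t -> t <= 1 -> (1 <= l)%nat ->
  pw l s * ln 2 * (t - s) <= pw l t - pw l s.
Proof.
  intros Hs Ht Hl. pose proof ln2_pos as L2.
  assert (E : pw l t = pw l s * exp (INR l * ln 2 * (/ s - / t))).
  { rewrite !pw_exp, <- exp_plus. f_equal. ring. }
  rewrite E. pose proof (exp_ineq1_le (INR l * ln 2 * (/ s - / t))) as H.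
  pose proof (pw_pos l s) as Hp.
  assert (H1 : ln 2 * (t - s) <= INR l * ln 2 * (/ s - / t)).
  { assert (1 <= INR l) by (change 1 with (INR 1); apply le_INR; auto).
    assert (t - s <= / s - / t).
    { rewrite inv_diff by lra. assert (0 < s * t <= 1) by nra.
      apply Rmult_le_reg_r with (s * t); [lra|].
      unfold Rdiv. rewrite Rmult_assoc, Rinv_l by lra. nra. }
    apply Rle_trans with (ln 2 * (/ s - / t)); [nra|].
    assert (0 <= ln 2 * (/ s - / t)) by nra. nra. }
  nra.
Qed.

Lemma pw_slope_up l s t : 0 < s <= t ->
  pw l t - pw l s <= pw l t * INR l * (ln 2 / (s * s)) * (t - s).
Proof.
  intros Hs. pose proof ln2_pos as L2.
  assert (E : pw l s = pw l t * exp (- (INR l * ln 2 * (/ s - / t)))).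
  { rewrite !pw_exp, <- exp_plus. f_equal. ring. }
  rewrite E. pose proof (exp_ineq1_le (- (INR l * ln 2 * (/ s - / t)))) as H.
  pose proof (pw_pos l t) as Hp. pose proof (pos_INR l) as Hl.
  assert (H1 : / s - / t <= / (s * s) * (t - s)).
  { rewrite inv_diff by lra. unfold Rdiv. rewrite Rmult_comm.
    apply Rmult_le_compat_r; [lra|]. apply Rinv_le_contravar; nra. }
  assert (H2 : INR l * ln 2 * (/ s - / t) <= INR l * ln 2 * (/ (s * s) * (t - s))).
  { apply Rmult_le_compat_l; auto. apply Rmult_le_pos; lra. }
  replace (pw l t * INR l * (ln 2 / (s * s)) * (t - s))
    with (pw l t * (INR l * ln 2 * (/ (s * s) * (t - s)))) by (unfold Rdiv; ring).
  nra.
Qed.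

(* [l <= exp (d l ln 2) / (d ln 2)] trades a factor [l] for a larger temperature. *)
Lemma pw_absorb s t : 0 < s < t -> exists B, 0 < B /\
  forall l, INR l * pw l s <= B * pw l t.
Proof.
  intros Hs. pose proof ln2_pos as L2.
  set (d := ln 2 * (/ s - / t)).
  assert (Hd : 0 < d).
  { apply Rmult_lt_0_compat; auto. assert (/ t < / s); [|lra].
    apply Rinv_lt_contravar; nra. }
  exists (/ d). split; [apply Rinv_0_lt_compat; auto|]. intros l.
  assert (E : pw l t = pw l s * exp (INR l * d)).
  { rewrite !pw_exp, <- exp_plus. f_equal. unfold d. ring. }
  rewrite E. pose proof (exp_ineq1_le (INR l * d)) as H. pose proof (pw_pos l s) as Hp.
  assert (H1 : INR l <= / d * exp (INR l * d)).
  { apply Rmult_le_reg_l with d; auto. rewrite <- Rmult_assoc, Rinv_r by lra. lra. }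
  replace (/ d * (pw l s * exp (INR l * d))) with (/ d * exp (INR l * d) * pw l s) by ring.
  apply Rmult_le_compat_r; lra.
Qed.

(** * The series [Theta] and its finite stages *)

Definition stage (V : mrec) (k : nat) (t : R) : R :=
  rsum k (fun x => if in_stage V k x then pw (len x) t else 0).

Definition weight (V : mrec) (t : R) (x : nat) : R :=
  if excluded_middle_informative (compressible V x) then pw (len x) t else 0.

Lemma weight_nonneg V t x : 0 <= weight V t x.
Proof. unfold weight. pose proof (pw_pos (len x) t). destruct excluded_middle_informative; lra. Qed.

Lemma map_add_seq c a m : map (fun y => (c + y)%nat) (seq a m) = seq (c + a) m.
Proof.
  revert a. induction m as [|m IH]; intros a; simpl; auto.
  rewrite IH, Nat.add_succ_r. reflexivity.
Qed.

Lemma in_all_strings n s : In s (all_strings n) -> length s = n.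
Proof.
  revert s. induction n as [|m IH]; simpl; intros s H; [intuition; subst; auto|].
  apply in_app_or in H as [H|H]; apply in_map_iff in H as [t [<- H]];
    simpl; f_equal; auto.
Qed.

Lemma map_val_all_strings n : map val (all_strings n) = seq 0 (2 ^ n).
Proof.
  induction n as [|n IH]; [reflexivity|].
  cbn [all_strings]. rewrite map_app, !map_map.
  rewrite (map_ext (fun x => val (false :: x)) val) by (intros; rewrite val_cons; lia).
  rewrite (map_ext_in (fun x => val (true :: x)) (fun x => (2 ^ n + val x)%nat))
    by (intros; rewrite val_cons, (in_all_strings n); auto).
  rewrite <- (map_map val (fun y => (2 ^ n + y)%nat)), IH, map_add_seq, Nat.add_0_r.
  rewrite Nat.pow_succ_r'. replace (2 * 2 ^ n)%nat with (2 ^ n + 2 ^ n)%nat by lia.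
  rewrite seq_app, <- IH. reflexivity.
Qed.

(** The strings of each length occupy consecutive codes in numerical order, so the terms of [Theta]
    tile the natural numbers and partial sums of the series become sums over an initial segment of
    codes. *)
Lemma map_enc_all_strings n : map enc (all_strings n) = seq (2 ^ n - 1) (2 ^ n).
Proof.
  rewrite (map_ext_in _ (fun s => (2 ^ n - 1 + val s)%nat)).
  - rewrite <- (map_map val (fun y => (2 ^ n - 1 + y)%nat)), map_val_all_strings.
    rewrite map_add_seq. f_equal. lia.
  - intros s Hs. apply in_all_strings in Hs. pose proof (enc_val s). subst.
    pose proof (two_pow_pos (length s)). lia.
Qed.

(** The general term of [Theta], in the same form, so that [Theta V T] converts to the series of
    [level V T]. *)
Definition level (V : mrec) (T : R) (n : nat) : R :=
  fold_right Rplus 0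
    (map (fun s => if excluded_middle_informative
                        (Rbar_lt (HC V s) (INR (length s)))
                   then Rpower 2 (- INR (length s) / T) else 0)
         (all_strings n)).

Lemma level_weight V T n :
  level V T n = fold_right Rplus 0 (map (weight V T) (seq (2 ^ n - 1) (2 ^ n))).
Proof.
  unfold level. rewrite <- map_enc_all_strings, map_map. f_equal. apply map_ext.
  intros s. unfold weight, pw. rewrite len_enc. pose proof (HC_lt_iff V s).
  do 2 destruct excluded_middle_informative; auto; tauto.
Qed.

Lemma sum_level V T n : sum_n (level V T) n = rsum (2 ^ S n - 1) (weight V T).
Proof.
  assert (H : forall m, rsum (2 ^ S m - 1) (weight V T) =
     rsum (2 ^ m - 1) (weight V T) + level V T m).
  { intros m. rewrite level_weight, <- rsum_seq. f_equal.
    rewrite Nat.pow_succ_r'. pose proof (two_pow_pos m). lia. }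
  induction n as [|n IH].
  - rewrite sum_O, H. simpl rsum. lra.
  - rewrite sum_Sn, IH, (H (S n)). reflexivity.
Qed.

(** There are [2^n] strings of length [n], of weight [2^(-n/T)] each; the ratio [2^(1 - 1/T)] is
    below 1 as soon as [T < 1]. *)
Lemma level_bound V T n : 0 < T -> 0 <= level V T n <= (2 * Rpower 2 (- / T)) ^ n.
Proof.
  intros HT. rewrite level_weight.
  assert (E : (2 * Rpower 2 (- / T)) ^ n = INR (2 ^ n) * pw n T).
  { rewrite Rpow_mult_distr, pow_INR. f_equal.
    rewrite <- Rpower_pow by apply exp_pos. rewrite Rpower_mult. unfold pw. f_equal.
    unfold Rdiv. ring. }
  rewrite E.
  assert (H : forall m a, (forall i, (i < m)%nat -> len (a + i) = n) ->
    0 <= fold_right Rplus 0 (map (weight V T) (seq a m)) <= INR m * pw n T).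
  { induction m as [|m IH]; intros a Ha; [simpl; lra|].
    destruct (IH (S a)) as [H1 H2].
    { intros i Hi. rewrite <- (Ha (S i)) by lia. f_equal. lia. }
    rewrite S_INR. cbn [seq map fold_right].
    pose proof (weight_nonneg V T a).
    assert (weight V T a <= pw n T).
    { unfold weight. replace (len a) with n
        by (rewrite <- (Ha 0%nat) by lia; f_equal; lia).
      destruct excluded_middle_informative; [lra|]. left; apply pw_pos. }
    lra. }
  apply H. intros i Hi. apply len_unique. pose proof (two_pow_pos n).
  rewrite Nat.pow_succ_r'. lia.
Qed.

Lemma Theta_limit V T : 0 < T < 1 -> is_lim_seq (sum_n (level V T)) (Theta V T).
Proof.
  intros HT. change (is_series (level V T) (Series (level V T))).
  apply Series_correct.
  apply (ex_series_le (level V T) (fun n => (2 * Rpower 2 (- / T)) ^ n)).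
  - intros n. destruct (level_bound V T n); [lra|].
    change (Rabs (level V T n) <= (2 * Rpower 2 (- / T)) ^ n).
    rewrite Rabs_pos_eq; auto.
  - apply ex_series_geom. rewrite Rabs_pos_eq.
    + replace 1 with (2 * Rpower 2 (Ropp 1)).
      * apply Rmult_lt_compat_l; [lra|]. apply Rpower_lt; [lra|].
        assert (/ 1 < / T); [|lra]. apply Rinv_lt_contravar; lra.
      * rewrite Rpower_Ropp, Rpower_1 by lra. field.
    + pose proof (exp_pos (- / T * ln 2)). unfold Rpower. lra.
Qed.

Lemma level_nonneg V T n : 0 < T -> 0 <= level V T n.
Proof. intros; apply level_bound; auto. Qed.

Lemma weight_sum_le_Theta V T m : 0 < T < 1 -> rsum m (weight V T) <= Theta V T.
Proof.
  intros HT. pose proof (Theta_limit V T HT) as L.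
  apply Rle_trans with (sum_n (level V T) m).
  - rewrite sum_level. apply rsum_mono; [|apply weight_nonneg].
    pose proof (Nat.pow_gt_lin_r 2 (S m) ltac:(lia)). lia.
  - apply is_lim_seq_incr_compare with (1 := L). intros n.
    rewrite sum_Sn. pose proof (level_nonneg V T (S n)).
    change plus with Rplus. lra.
Qed.

Lemma weight_sum_close V T d : 0 < T < 1 -> 0 < d ->
  exists m, Theta V T - d < rsum m (weight V T).
Proof.
  intros HT Hd. pose proof (Theta_limit V T HT) as L.
  apply is_lim_seq_spec in L. destruct (L (mkposreal d Hd)) as [n Hn].
  specialize (Hn n (le_n n)). simpl in Hn. rewrite sum_level in Hn.
  exists (2 ^ S n - 1)%nat. apply Rabs_def2 in Hn. lra.
Qed.

Lemma stage_extend V k m t : (k <= m)%nat ->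
  stage V k t = rsum m (fun x => if in_stage V k x then pw (len x) t else 0).
Proof.
  intros H. symmetry. apply rsum_extend; auto. intros i Hi.
  destruct (in_stage V k i) eqn:E; auto. apply in_stage_sound in E. lia.
Qed.

Lemma in_stage_weight_le V k t x : (if in_stage V k x then pw (len x) t else 0) <= weight V t x.
Proof.
  unfold weight. pose proof (pw_pos (len x) t).
  destruct (in_stage V k x) eqn:E; destruct excluded_middle_informative as [|n]; try lra.
  destruct n. apply in_stage_sound in E; tauto.
Qed.

Lemma stage_le_Theta V k T : 0 < T < 1 -> stage V k T <= Theta V T.
Proof.
  intros HT. apply Rle_trans with (2 := weight_sum_le_Theta V T k HT).
  apply rsum_le. intros; apply in_stage_weight_le.
Qed.

(** Finitely many codes carry all of [Theta] but [d], and the compressible ones among them belong to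
    every late stage. *)
Lemma stage_close V T d : 0 < T < 1 -> 0 < d ->
  exists k0, forall k, (k0 <= k)%nat -> Theta V T - d < stage V k T.
Proof.
  intros HT Hd. destruct (weight_sum_close V T d HT Hd) as [m Hm].
  destruct (eventually_forall_lt (fun x k => compressible V x -> in_stage V k x = true) m)
    as [k1 H1].
  { intros x _. destruct (classic (compressible V x)) as [H|H]; [|exists 0%nat; tauto].
    destruct (in_stage_complete V x H) as [k0 H0]. eauto. }
  exists (k1 + m)%nat. intros k Hk. apply Rlt_le_trans with (1 := Hm).
  apply Rle_trans with (rsum m (fun x => if in_stage V k x then pw (len x) T else 0)).
  - apply rsum_le. intros x Hx. unfold weight.
    destruct excluded_middle_informative as [Hw|Hw].
    + rewrite (H1 x Hx k); auto; [lra|lia].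
    + pose proof (pw_pos (len x) T). destruct (in_stage V k x); lra.
  - apply rsum_mono; [lia|]. intros x. pose proof (pw_pos (len x) T).
    destruct (in_stage V k x); lra.
Qed.

(** An unseen string contributes its whole weight to the missing part of the sum. A bound on the
    missing part thus becomes a lower bound on the length of every unseen compressible string. *)
Lemma stage_missed V k T x : 0 < T < 1 -> compressible V x -> in_stage V k x = false ->
  stage V k T + pw (len x) T <= Theta V T.
Proof.
  intros HT Hx Hk. set (m := (k + S x)%nat).
  apply Rle_trans with (2 := weight_sum_le_Theta V T m HT).
  rewrite (stage_extend V k m) by (unfold m; lia).
  apply Rle_trans with (rsum m (fun i => (if in_stage V k i then pw (len i) T else 0) +
      (if Nat.eq_dec i x then pw (len x) T else 0))).
  - rewrite rsum_plus. apply Rplus_le_compat_l.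
    set (g := fun i => if Nat.eq_dec i x then pw (len x) T else 0).
    replace (pw (len x) T) with (g x)
      by (unfold g; destruct (Nat.eq_dec x x); auto; lia).
    apply rsum_single; [unfold m; lia|]. intros i. unfold g.
    pose proof (pw_pos (len x) T). destruct Nat.eq_dec; lra.
  - apply rsum_le. intros i _. destruct (Nat.eq_dec i x) as [->|Hne].
    + rewrite Hk. unfold weight. destruct excluded_middle_informative; [lra|tauto].
    + pose proof (in_stage_weight_le V k T i). lra.
Qed.

Lemma stage_mono V k s t : 0 < s <= t -> stage V k s <= stage V k t.
Proof.
  intros H. apply rsum_le. intros x _. destruct (in_stage V k x); [apply pw_le; auto|lra].
Qed.

(** Every term is nondecreasing in the temperature, so the slope of the single term [x] is a lower
    bound, the same for all stages containing [x]. *)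
Lemma stage_slope_low V k x s t :
  in_stage V k x = true -> 0 < s <= t -> t <= 1 ->
  stage V k s + pw (len x) s * ln 2 * (t - s) <= stage V k t.
Proof.
  intros Hx Hs Ht. destruct (in_stage_sound _ _ _ Hx) as [Hk [p [_ Hp]]].
  (* A compressible string is nonempty, being longer than one of its programs. *)
  pose proof (pw_slope_low (len x) s t Hs Ht ltac:(lia)) as H.
  set (f := fun x => if in_stage V k x then pw (len x) t - pw (len x) s else 0).
  assert (E : stage V k t = stage V k s + rsum k f).
  { unfold stage, f. rewrite <- rsum_plus. apply rsum_ext. intros i _.
    destruct (in_stage V k i); lra. }
  rewrite E. apply Rplus_le_compat_l.
  apply Rle_trans with (1 := H). replace (pw (len x) t - pw (len x) s) with (f x)
    by (unfold f; rewrite Hx; auto).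
  apply rsum_single; auto. intros i. unfold f. destruct (in_stage V k i); [|lra].
  pose proof (pw_le (len i) s t Hs). lra.
Qed.

(** Differentiating [2^(-l/t)] brings out a factor [l]. It is absorbed by moving to a temperature
    [t1] between [t0] and 1, where the series still converges and bounds all stages at once. *)
Lemma stage_slope_up V T t0 : 0 < T < t0 -> t0 < 1 -> exists C, 0 < C /\
  forall k t, T <= t <= t0 -> stage V k t - stage V k T <= C * (t - T).
Proof.
  intros HT Ht0. set (t1 := (t0 + 1) / 2).
  destruct (pw_absorb t0 t1) as [B [HB Habs]]; [unfold t1; lra|].
  pose proof ln2_pos as L2.
  assert (Hc : 0 < ln 2 / (T * T)) by (apply Rdiv_lt_0_compat; nra).
  (* The empty partial sum gives [0 <= Theta V t1]; the summand 1 in the next witness then makes the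
     constant positive. *)
  pose proof (weight_sum_le_Theta V t1 0 ltac:(unfold t1; lra)) as Hth. cbn [rsum] in Hth.
  exists (ln 2 / (T * T) * B * Theta V t1 + 1). split.
  { assert (0 <= ln 2 / (T * T) * B) by nra. nra. }
  intros k t Ht.
  apply Rle_trans with (ln 2 / (T * T) * B * stage V k t1 * (t - T)).
  - replace (ln 2 / (T * T) * B * stage V k t1 * (t - T))
      with (ln 2 / (T * T) * B * (t - T) * stage V k t1) by ring.
    unfold stage at 3. rewrite <- rsum_scal.
    apply Rle_minus_l. unfold stage. rewrite <- rsum_plus.
    apply rsum_le. intros x _. destruct (in_stage V k x); [|lra].
    pose proof (pw_slope_up (len x) T t ltac:(lra)) as H.
    pose proof (pw_le (len x) t t0 ltac:(lra)) as H1.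
    pose proof (Habs (len x)) as H2. pose proof (pos_INR (len x)) as H3.
    assert (H4 : pw (len x) t * INR (len x) <= B * pw (len x) t1) by nra.
    assert (H5 : 0 <= ln 2 / (T * T) * (t - T)) by nra.
    nra.
  - apply Rmult_le_compat_r; [lra|].
    pose proof (stage_le_Theta V k t1 ltac:(unfold t1; lra)).
    assert (0 <= ln 2 / (T * T) * B) by nra. nra.
Qed.

(* An [x] enumerated after stage [k] has weight at most [tau] at temperature [r],
   and its weight at [T] is the [r/T]-th power of that. *)
Lemma stage_tail V k r T tau : 0 < T < r -> r < 1 -> 0 < tau ->
  Theta V r - stage V k r <= tau ->
  Theta V T - stage V k T <= Rpower tau (r / T).
Proof.
  intros HT Hr Htau Hk.
  assert (Hp : forall m, (k <= m)%nat ->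
    rsum m (weight V T) - stage V k T <= Rpower tau (r / T)).
  { intros m Hm. rewrite (stage_extend V k m T Hm).
    pose proof (weight_sum_le_Theta V r m ltac:(lra)) as Hr1.
    rewrite (stage_extend V k m r Hm) in Hk.
    set (f := fun t x => if in_stage V k x then 0 else weight V t x).
    assert (E : forall t, rsum m (weight V t) =
      rsum m (fun x => if in_stage V k x then pw (len x) t else 0) + rsum m (f t)).
    { intros t. rewrite <- rsum_plus. apply rsum_ext. intros i _. unfold f, weight.
      destruct (in_stage V k i) eqn:Ei; [|lra]. apply in_stage_sound in Ei.
      destruct excluded_middle_informative; [lra|tauto]. }
    rewrite E in Hr1. rewrite E.
    (* Termwise: if [w <= tau] is the weight at [r], the weight at [T] is [w^(r/T - 1) w], with a
       positive exponent. *)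
    assert (H1 : rsum m (f T) <= Rpower tau (r / T - 1) * rsum m (f r)).
    { rewrite <- rsum_scal. apply rsum_le. intros x _. unfold f.
      destruct (in_stage V k x) eqn:Ex; [lra|]. unfold weight.
      destruct excluded_middle_informative as [Hw|]; [|lra].
      pose proof (stage_missed V k r x ltac:(lra) Hw Ex) as H.
      rewrite (stage_extend V k m r Hm) in H.
      assert (Hx : pw (len x) r <= tau) by lra.
      assert (E2 : pw (len x) T = Rpower (pw (len x) r) (r / T - 1) * pw (len x) r).
      { rewrite <- (Rpower_1 (pw (len x) r)) at 2 by apply pw_pos.
        rewrite <- Rpower_plus. unfold pw. rewrite Rpower_mult. f_equal. field. lra. }
      rewrite E2. apply Rmult_le_compat_r; [left; apply pw_pos|].
      apply Rle_Rpower_l; [|split; auto; apply pw_pos].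
      assert (1 <= r / T); [|lra]. apply Rmult_le_reg_r with T; [lra|].
      unfold Rdiv. rewrite Rmult_assoc, Rinv_l by lra. lra. }
    assert (H2 : rsum m (f r) <= tau) by lra.
    apply Rle_trans with (Rpower tau (r / T - 1) * tau).
    - apply Rle_trans with (Rpower tau (r / T - 1) * rsum m (f r)); [lra|].
      apply Rmult_le_compat_l; auto. left; apply exp_pos.
    - rewrite <- (Rpower_1 tau) at 2 by auto. rewrite <- Rpower_plus.
      right. f_equal. ring. }
  (* Passage to the limit: if [Theta] violated the bound, a partial sum close enough to it would
     violate it as well. *)
  destruct (Rle_or_lt (Theta V T - stage V k T) (Rpower tau (r / T))) as [|Hc]; auto.
  destruct (weight_sum_close V T (Theta V T - stage V k T - Rpower tau (r / T)))
    as [m Hm]; [lra|lra|].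
  specialize (Hp (k + m)%nat ltac:(lia)).
  pose proof (rsum_mono m (k + m) (weight V T) ltac:(lia) (weight_nonneg V T)). lra.
Qed.

(** * Rational approximations *)

(** The floor of [N 2^(-l/t)] at [t = P/Q], by counting the positive integers [a <= N] with
    [a <= N 2^(-lQ/P)], an inequality raised to the power [P] to stay among integers. *)
Definition floor_pw (N l P Q : nat) : nat :=
  bsum N (fun a => Nat.b2n ((S a) ^ P * 2 ^ (l * Q) <=? N ^ P)%nat).

Lemma two_pow_INR n : INR (2 ^ n) = 2 ^ n.
Proof. rewrite pow_INR. reflexivity. Qed.

Lemma pow_lt_l x y n : 0 <= x < y -> (1 <= n)%nat -> x ^ n < y ^ n.
Proof.
  intros H Hn. induction Hn as [|n Hn IH]; simpl; [lra|].
  pose proof (pow_le x n ltac:(lra)). nra.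
Qed.

Lemma floor_pw_spec N l P Q : (1 <= P)%nat -> (1 <= Q)%nat ->
  INR (floor_pw N l P Q) <= INR N * pw l (INR P / INR Q) < INR (floor_pw N l P Q) + 1.
Proof.
  intros HP HQ.
  assert (HP' : 1 <= INR P) by (change 1 with (INR 1); apply le_INR; auto).
  assert (HQ' : 1 <= INR Q) by (change 1 with (INR 1); apply le_INR; auto).
  set (q := pw l (INR P / INR Q)).
  assert (Hq : 0 < q) by apply pw_pos.
  pose proof (pos_INR N) as HN.
  assert (Hq1 : q <= 1).
  { unfold q. rewrite pw_exp, <- exp_0.
    assert (H : 0 <= INR l * ln 2 * / (INR P / INR Q)).
    { pose proof (pos_INR l). pose proof ln2_pos.
      apply Rmult_le_pos; [nra|]. left. apply Rinv_0_lt_compat, Rdiv_lt_0_compat; lra. }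
    destruct H as [H|H]; [left; apply exp_increasing; lra|]. rewrite <- H. right. f_equal. lra. }
  assert (HqP : q ^ P * 2 ^ (l * Q) = 1).
  { rewrite <- !Rpower_pow by lra. unfold q, pw. rewrite Rpower_mult, <- Rpower_plus.
    rewrite <- (Rpower_O 2) by lra. f_equal. rewrite mult_INR. field. lra. }
  destruct (nfloor_ex (INR N * q)) as [f Hf]; [nra|].
  assert (HfN : (f <= N)%nat) by (apply INR_le; nra).
  replace (floor_pw N l P Q) with f; auto.
  rewrite <- (bsum_leb N f HfN) at 1. apply bsum_ext. intros a _. f_equal.
  apply Bool.eq_iff_eq_true. rewrite !Nat.leb_le.
  assert (E : ((S a) ^ P * 2 ^ (l * Q) <= N ^ P)%nat <-> INR (S a) ^ P <= (INR N * q) ^ P).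
  { pose proof (pow_lt 2 (l * Q) ltac:(lra)) as H2.
    rewrite Rpow_mult_distr.
    split; intros H.
    - apply le_INR in H. rewrite mult_INR, !pow_INR in H.
      change (INR 2) with 2 in H.
      apply Rmult_le_reg_r with (1 := H2). rewrite Rmult_assoc, HqP. lra.
    - apply INR_le. rewrite mult_INR, !pow_INR. change (INR 2) with 2.
      apply Rmult_le_compat_r with (r := 2 ^ (l * Q)) in H; [|lra].
      rewrite Rmult_assoc, HqP in H. lra. }
  rewrite E. pose proof (pos_INR (S a)) as Ha. split; intros H.
  - apply pow_incr. split; auto. apply le_INR in H. lra.
  - destruct (Nat.le_gt_cases (S a) f) as [|Hlt]; auto. exfalso.
    apply le_INR in Hlt. rewrite S_INR in Hlt.
    assert (Hc : (INR N * q) ^ P < INR (S a) ^ P); [|lra].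
    apply pow_lt_l; auto. nra.
Qed.

Definition stage_floor (V : mrec) (N k P Q : nat) : nat :=
  bsum k (fun x => if in_stage V k x then floor_pw N (len x) P Q else 0%nat).

(** Each of at most [k] floors loses less than 1. With [N = (k+1)^2] the error after division by [N]
    is at most [1/(k+1)]. *)
Lemma stage_floor_spec V N k P Q : (1 <= P)%nat -> (1 <= Q)%nat ->
  INR (stage_floor V N k P Q) <= INR N * stage V k (INR P / INR Q)
    <= INR (stage_floor V N k P Q) + INR k.
Proof.
  intros HP HQ.
  assert (H : forall m,
    INR (bsum m (fun x => if in_stage V k x then floor_pw N (len x) P Q else 0%nat)) <=
    INR N * rsum m (fun x => if in_stage V k x then pw (len x) (INR P / INR Q) else 0) <=
    INR (bsum m (fun x => if in_stage V k x then floor_pw N (len x) P Q else 0%nat)) + INR m);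
    [|apply H].
  induction m as [|m IH]; [simpl; lra|].
  rewrite S_INR. cbn [bsum rsum]. rewrite plus_INR.
  destruct (in_stage V k m); [|simpl (INR 0); lra].
  pose proof (floor_pw_spec N (len m) P Q HP HQ). lra.
Qed.

Lemma rec_stage_floor V n N k P Q : rec n N -> rec n k -> rec n P -> rec n Q ->
  rec n (fun v => stage_floor V (N v) (k v) (P v) (Q v)).
Proof.
  intros HN Hk HP HQ. unfold stage_floor, floor_pw.
  assert (H : recb (S n) (fun u => in_stage V (k (tl u)) (hd 0%nat u)))
    by (apply recb_in_stage; rec_solve).
  apply (rec_bsum n k (fun x v => if in_stage V (k v) x then
    bsum (N v) (fun a => Nat.b2n ((S a) ^ P v * 2 ^ (len x * Q v) <=? N v ^ P v)%nat)
    else 0%nat)); auto.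
  apply rec_if; [exact H| |rec_solve].
  apply (rec_bsum _ (fun u => N (tl u)) (fun a u =>
     Nat.b2n ((S a) ^ P (tl u) * 2 ^ (len (hd 0%nat u) * Q (tl u)) <=? N (tl u) ^ P (tl u))%nat));
    rec_solve.
Qed.

(** Signs are removed for the sake of arithmetic on natural numbers; the index is shifted because
    approximations start at 1. *)
Lemma computable_approx alpha : 0 <= alpha -> computable_real alpha ->
  exists num den : nat -> nat, rec1 num /\ rec1 den /\
    forall q, (0 < den q)%nat /\
      Rabs (alpha - INR (num q) / INR (den q)) < 1 / INR (S q).
Proof.
  intros Ha [e [Htot He]].
  set (F := fun q => epsilon (inhabits 0%nat) (fun m => eval e [S q] m)).
  assert (HF : forall q, eval e [S q] (F q)).
  { intros q. unfold F. apply epsilon_spec. apply Htot. lia. }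
  assert (RF : rec1 F).
  { exists (MComp e [MSucc]). intros [|q [|? v]] Hv; try discriminate.
    apply ev_comp with [S q]; [|apply HF]. constructor; constructor. }
  (* An even code [a] stands for the numerator [a/2], whence the doubled denominator. An odd code
     stands for a negative rational, and 0 is closer to [alpha >= 0]. *)
  exists (fun q => if Nat.even (cfst (F q)) then cfst (F q) else 0%nat),
    (fun q => 2 * S (csnd (F q)))%nat.
  assert (RF' : rec 1 (fun v => F (hd 0%nat v))) by exact RF.
  split; [unfold rec1; rec_solve|]. split; [unfold rec1; rec_solve|].
  intros q. split; [lia|].
  pose proof (He (S q) (F q) ltac:(lia) (HF q)) as H. unfold decode_rat in H.
  unfold cfst, csnd. destruct (unpair (F q)) as [a b]. simpl fst; simpl snd.
  unfold zig in H. rewrite mult_INR. change (INR 2) with 2.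
  assert (Hb : 0 < INR (S b)) by apply lt_0_INR, Nat.lt_0_succ.
  destruct (Nat.even a) eqn:E.
  - rewrite <- INR_IZR_INZ in H.
    assert (E2 : INR a = 2 * INR (Nat.div2 a)).
    { change 2 with (INR 2). rewrite <- mult_INR. f_equal.
      apply Nat.even_spec in E as [c ->]. rewrite Nat.div2_double. auto. }
    rewrite E2. replace (2 * INR (Nat.div2 a) / (2 * INR (S b)))
      with (INR (Nat.div2 a) / INR (S b)) by (field; lra). auto.
  - apply Rle_lt_trans with (2 := H).
    simpl (INR 0). unfold Rdiv. rewrite Rmult_0_l, Rminus_0_r, Rabs_pos_eq by auto.
    rewrite opp_IZR, <- INR_IZR_INZ.
    pose proof (pos_INR (Nat.div2 (S a))). pose proof (Rinv_0_lt_compat _ Hb).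
    rewrite Rabs_pos_eq; nra.
Qed.

Definition bin_floor (T : R) (n : nat) : nat := Z.to_nat (Int_part (T * 2 ^ n)).

Lemma bin_floor_Z T n : 0 < T < 1 -> Int_part (T * 2 ^ n) = Z.of_nat (bin_floor T n).
Proof.
  intros HT. unfold bin_floor. rewrite Z2Nat.id; auto.
  destruct (base_Int_part (T * 2 ^ n)) as [_ H].
  pose proof (pow_lt 2 n ltac:(lra)).
  assert (0 < T * 2 ^ n) by (apply Rmult_lt_0_compat; lra).
  assert (Hz : IZR (-1) < IZR (Int_part (T * 2 ^ n))) by lra.
  apply lt_IZR in Hz. lia.
Qed.

Lemma bin_floor_spec T n : 0 < T < 1 ->
  INR (bin_floor T n) <= T * 2 ^ n < INR (bin_floor T n) + 1.
Proof.
  intros HT. rewrite INR_IZR_INZ, <- bin_floor_Z by auto.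
  pose proof (base_Int_part (T * 2 ^ n)). lra.
Qed.

Lemma bin_floor_S T n : 0 < T < 1 ->
  bin_floor T (S n) = (2 * bin_floor T n + (if bit T (S n) then 1 else 0))%nat.
Proof.
  intros HT.
  assert (E : bit T (S n) = Nat.odd (bin_floor T (S n))).
  { unfold bit, frac_part. assert (H0 : Int_part T = 0%Z).
    { symmetry. apply Int_part_spec. simpl. lra. }
    rewrite H0, Rminus_0_r, bin_floor_Z by auto.
    apply Bool.eq_iff_eq_true. rewrite Z.odd_spec, Nat.odd_spec. split.
    - intros [z Hz]. exists (Z.to_nat z). lia.
    - intros [m Hm]. exists (Z.of_nat m). lia. }
  rewrite E. pose proof (bin_floor_spec T n HT) as H1.
  pose proof (bin_floor_spec T (S n) HT) as H2. simpl pow in H2.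
  assert (Hlo : (2 * bin_floor T n < S (bin_floor T (S n)))%nat).
  { apply INR_lt. rewrite mult_INR. change (INR 2) with 2. rewrite S_INR. lra. }
  assert (Hhi : (bin_floor T (S n) < 2 * bin_floor T n + 2)%nat).
  { apply INR_lt. rewrite plus_INR, mult_INR. change (INR 2) with 2. lra. }
  destruct (Nat.odd (bin_floor T (S n))) eqn:O.
  - apply Nat.odd_spec in O as [m Hm]. lia.
  - assert (O' : Nat.even (bin_floor T (S n)) = true)
      by (rewrite <- Nat.negb_odd, O; auto).
    apply Nat.even_spec in O' as [m Hm]. lia.
Qed.

Lemma length_restr T n : length (restr T n) = n.
Proof. unfold restr. rewrite length_map, length_seq. auto. Qed.

Lemma val_restr T n : 0 < T < 1 -> val (restr T n) = bin_floor T n.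
Proof.
  intros HT. induction n as [|n IH].
  - pose proof (bin_floor_spec T 0 HT) as [H _]. simpl pow in H.
    assert (H1 : (bin_floor T 0 < 1)%nat) by (apply INR_lt; simpl; lra).
    change (val (restr T 0)) with 0%nat. lia.
  - rewrite bin_floor_S, <- IH by auto. unfold restr.
    rewrite seq_S, map_app, val_app. simpl map. cbn [length].
    change (1 + n)%nat with (S n). unfold val at 2. simpl. lia.
Qed.

Lemma enc_restr T n : 0 < T < 1 -> S (enc (restr T n)) = (2 ^ n + bin_floor T n)%nat.
Proof. intros. rewrite enc_val, length_restr, val_restr; auto. Qed.

Open Scope nat_scope.

(** * Weak randomness *)

Definition header (j : nat) (w : bstring) : bstring := repeat true j ++ false :: w.

Lemma header_inj j w : forall j' w' r,
  header j' w' = header j w ++ r -> j' = j /\ w' = w ++ r.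
Proof.
  unfold header. induction j as [|j IH]; intros [|j'] w' r H; simpl in H;
    try discriminate; injection H as H.
  - auto.
  - destruct (IH _ _ _ H). auto.
Qed.

Lemma length_header j w : length (header j w) = j + 1 + length w.
Proof. unfold header. rewrite length_app, repeat_length. simpl. lia. Qed.

(** The block of ones delimits itself and determines the length of the rest, so no admissible input
    properly extends another. *)
Lemma header_prefix_free e L c :
  (forall p s, run e p s -> exists j w, p = header j w /\ length w = L * j + c) ->
  prefix_free e.
Proof.
  intros H p q s t Hp Hq [r E].
  destruct (H _ _ Hp) as [j [w [-> Hw]]]. destruct (H _ _ Hq) as [j' [w' [-> Hw']]].
  destruct (header_inj _ _ _ _ _ E) as [-> ->]. rewrite length_app in Hw'.
  destruct r; [rewrite app_nil_r; auto|simpl in Hw'; lia].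
Qed.

Lemma enc_header j w :
  S (enc (header j w)) = (2 ^ S j - 1) * 2 ^ S (length w) + val w.
Proof.
  rewrite enc_val, length_header. unfold header. rewrite val_app, val_cons.
  assert (E : S (val (repeat true j)) = 2 ^ j).
  { induction j as [|j IH]; [reflexivity|].
    simpl repeat. rewrite val_cons, repeat_length, Nat.pow_succ_r'. lia. }
  simpl length. replace (j + 1 + length w) with (j + S (length w)) by lia.
  rewrite Nat.pow_add_r. rewrite (Nat.pow_succ_r' 2 j). rewrite <- E. nia.
Qed.

(** Decides on codes that [y] is [1^j 0 w] with [|w| = L j + c] and [w] of binary value [b]; the
    digits of [S y] are then [j + 1] ones, a zero, and [w]. *)
Definition header_code (L c y j b : nat) : bool :=
  (S y =? (2 ^ S j - 1) * 2 ^ S (L * j + c) + b) && (b <? 2 ^ (L * j + c)).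

Lemma header_code_iff L c p j b : header_code L c (enc p) j b = true <->
  exists w, p = header j w /\ length w = L * j + c /\ val w = b.
Proof.
  unfold header_code. rewrite Bool.andb_true_iff, Nat.eqb_eq, Nat.ltb_lt. split.
  - intros [H Hb]. destruct (val_surj _ _ Hb) as [w [Hl Hv]]. exists w.
    split; auto. apply enc_inj. pose proof (enc_header j w) as E. rewrite Hl, Hv in E. lia.
  - intros [w [-> [Hl <-]]]. rewrite enc_header, Hl, <- Hl. split; auto. apply val_lt.
Qed.

Lemma len_ge x l : 2 ^ l <= S x -> l <= len x.
Proof. intros H. apply Nat.log2_le_pow2; lia. Qed.

(* The machine sending [1^j 0] to a string of length at least [2j + 2] compresses for
   large [j]. *)
Lemma compressible_exists V : optimal V -> exists x, compressible V x.
Proof.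
  intros [_ HV].
  destruct (search_machine (fun y z => header_code 0 0 y z 0) (fun y z => S y * S y))
    as [e He].
  { unfold header_code. rec_solve. }
  { unfold rec2. rec_solve. }
  destruct (HV e) as [d Hd].
  { apply (header_prefix_free e 0 0). intros p s Hp. apply He in Hp as [z [[Hz _] _]].
    apply header_code_iff in Hz as [w [? [? _]]]. eauto. }
  (* With [j = d] the program for [V] has length at most [(d + 1) + d], below the output length
     [2d + 2]; squaring [S y] is what doubles the length. *)
  set (p := header d []).
  destruct (least_exists (fun z => header_code 0 0 (enc p) z 0)) as [z Hz].
  { exists d. apply header_code_iff. exists []. auto. }
  set (x := S (enc p) * S (enc p)).
  assert (Hx : eval e [enc p] x) by (apply He; eauto).
  destruct (enc_surj x) as [s Hs]. exists (enc s). apply compressible_enc.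
  destruct (Hd p s) as [q [Hq Hl]]; [unfold run; rewrite Hs; auto|].
  exists q. split; auto.
  assert (Hlen : 2 * d + 2 <= len x).
  { apply len_ge. unfold x, p. rewrite enc_header. simpl length.
    change (2 ^ 1) with 2. change (val []) with 0.
    replace (2 * d + 2) with (S d + S d) by lia. rewrite Nat.pow_add_r.
    pose proof (two_pow_pos d). rewrite !Nat.pow_succ_r'. nia. }
  rewrite <- (len_enc s), Hs. unfold p in Hl. rewrite length_header in Hl. simpl in Hl. lia.
Qed.

(** Pigeonhole: there are [2^m] strings of length [m] and only [2^m - 1] programs shorter than
    [m]. *)
Lemma incompressible V m : exists x, len x = m /\ ~ compressible V x.
Proof.
  apply NNPP. intros Hno.
  assert (H : forall x, len x = m -> exists p, eval V [p] x /\ len p < m).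
  { intros x Hx. apply NNPP. intros H. apply Hno. exists x. split; auto.
    intros [p [Hp Hl]]. apply H. exists p. rewrite <- Hx. auto. }
  set (f := fun x => epsilon (inhabits 0) (fun p => eval V [p] x /\ len p < m)).
  assert (Hf : forall x, len x = m -> eval V [f x] x /\ len (f x) < m).
  { intros x Hx. unfold f. apply epsilon_spec. auto. }
  pose proof (two_pow_pos m) as H2.
  assert (Hin : forall x, In x (seq (2 ^ m - 1) (2 ^ m)) -> len x = m).
  { intros x Hx. apply in_seq in Hx. apply len_unique. rewrite Nat.pow_succ_r'. lia. }
  assert (Hnd : NoDup (map f (seq (2 ^ m - 1) (2 ^ m)))).
  { apply NoDup_map_NoDup_ForallPairs; [|apply seq_NoDup].
    intros x y Hx Hy E. destruct (Hf x (Hin x Hx)) as [Ex _].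
    destruct (Hf y (Hin y Hy)) as [Ey _]. rewrite E in Ex. eapply eval_fun; eauto. }
  apply NoDup_incl_length with (l' := seq 0 (2 ^ m - 1)) in Hnd.
  - rewrite length_map, !length_seq in Hnd. lia.
  - intros p Hp. apply in_map_iff in Hp as [x [<- Hx]].
    destruct (Hf x (Hin x Hx)) as [_ Hl]. apply in_seq.
    pose proof (len_spec (f x)) as [_ Hs].
    pose proof (Nat.pow_le_mono_r 2 (S (len (f x))) m). lia.
Qed.

Open Scope R_scope.

Lemma INR_ge1 n : (1 <= n)%nat -> 1 <= INR n.
Proof. intros H. change 1 with (INR 1). apply le_INR; auto. Qed.

Lemma exists_pow2_small d : 0 < d -> exists n0, forall n, (n0 <= n)%nat -> / 2 ^ n < d.
Proof.
  intros Hd. destruct (pow_lt_1_zero (/ 2) ltac:(rewrite Rabs_pos_eq; lra) d Hd) as [n0 H].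
  exists n0. intros n Hn. specialize (H n Hn). rewrite pow_inv in H.
  rewrite Rabs_pos_eq in H; auto. left. apply Rinv_0_lt_compat, pow_lt. lra.
Qed.

Lemma exists_nat_ge r : exists n, r <= INR n.
Proof.
  destruct (nfloor_ex (Rmax r 0) (Rmax_r _ _)) as [n Hn]. exists (S n).
  rewrite S_INR. pose proof (Rmax_l r 0). lra.
Qed.

Lemma exists_pow2_ge r : exists n, r <= 2 ^ n.
Proof.
  destruct (exists_nat_ge r) as [n Hn]. exists n. apply Rle_trans with (1 := Hn).
  rewrite <- two_pow_INR. apply le_INR. pose proof (Nat.pow_gt_lin_r 2 n ltac:(lia)). lia.
Qed.

Lemma exists_nat_inv d : 0 < d -> exists k0, forall k, (k0 <= k)%nat -> / INR (S k) < d.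
Proof.
  intros Hd. destruct (exists_nat_ge (/ d)) as [k0 H0]. exists k0. intros k Hk.
  rewrite <- (Rinv_inv d). apply Rinv_lt_contravar.
  - apply Rmult_lt_0_compat; [apply Rinv_0_lt_compat; auto|apply lt_0_INR; lia].
  - rewrite S_INR. apply le_INR in Hk. lra.
Qed.

(** Taking logarithms, [l/T > n - c], so [l > T n - T c], and [T c <= c]. *)
Lemma pw_missed l T n c C : 0 < T < 1 -> C <= 2 ^ c -> pw l T < C * / 2 ^ n ->
  T * INR n - INR c < INR l.
Proof.
  intros HT HC H.
  assert (H1 : pw l T < Rpower 2 (INR c - INR n)).
  { apply Rlt_le_trans with (1 := H). unfold Rminus. rewrite Rpower_plus, Rpower_Ropp.
    rewrite !Rpower_pow by lra. apply Rmult_le_compat_r; auto.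
    left. apply Rinv_0_lt_compat, pow_lt. lra. }
  unfold pw in H1. destruct (Rlt_or_le (- INR l / T) (INR c - INR n)) as [Hlt|Hge].
  - apply Rmult_lt_compat_r with (r := T) in Hlt; [|lra].
    unfold Rdiv in Hlt. rewrite Rmult_assoc, Rinv_l in Hlt by lra.
    pose proof (pos_INR c). nra.
  - apply Rle_Rpower with (e := 2) in Hge; lra.
Qed.

(* Certifies [theta < stage V k (P/Q)], where [num/den] approximates [theta], with
   precision [1/(k+1)]. *)
Definition exceeds (V : mrec) (num den : nat -> nat) (k P Q : nat) : bool :=
  (num k * (S k * S k) + den k * S k <? stage_floor V (S k * S k) k P Q * den k)%nat.

Definition approximates (alpha : R) (num den : nat -> nat) : Prop :=
  forall q, (0 < den q)%nat /\ Rabs (alpha - INR (num q) / INR (den q)) < 1 / INR (S q).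

Lemma exceeds_iff V num den k P Q : (0 < den k)%nat ->
  exceeds V num den k P Q = true <->
  INR (num k) / INR (den k) + / INR (S k) <
    INR (stage_floor V (S k * S k) k P Q) / (INR (S k) * INR (S k)).
Proof.
  intros Hd. unfold exceeds. rewrite Nat.ltb_lt.
  assert (Hk : 0 < INR (S k)) by (apply lt_0_INR; lia). apply lt_0_INR in Hd.
  set (a := INR (num k)). set (b := INR (den k)) in *. set (m := INR (S k)) in *.
  set (s := INR (stage_floor V (S k * S k) k P Q)).
  assert (E : a / b + / m < s / (m * m) <-> a * (m * m) + b * m < s * b).
  { assert (Hp : 0 < b * (m * m)) by (repeat apply Rmult_lt_0_compat; auto).
    replace (a * (m * m) + b * m) with ((a / b + / m) * (b * (m * m))) by (field; lra).
    replace (s * b) with (s / (m * m) * (b * (m * m))) by (field; lra).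
    split; intros H; [apply Rmult_lt_compat_r|apply Rmult_lt_reg_r in H]; auto. }
  rewrite E. unfold a, b, m, s. rewrite <- !mult_INR, <- plus_INR. split.
  - apply lt_INR.
  - apply INR_lt.
Qed.

Lemma exceeds_sound V theta num den k P Q :
  approximates theta num den -> (1 <= P)%nat -> (1 <= Q)%nat ->
  exceeds V num den k P Q = true -> theta < stage V k (INR P / INR Q).
Proof.
  intros Ha HP HQ H. destruct (Ha k) as [Hd Hk]. apply exceeds_iff in H; auto.
  destruct (stage_floor_spec V (S k * S k) k P Q HP HQ) as [Hs _].
  rewrite mult_INR in Hs. assert (Hk1 : 0 < INR (S k)) by (apply lt_0_INR; lia).
  assert (Hs' : INR (stage_floor V (S k * S k) k P Q) / (INR (S k) * INR (S k)) <=
    stage V k (INR P / INR Q)).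
  { apply Rmult_le_reg_r with (INR (S k) * INR (S k)); [nra|].
    unfold Rdiv at 1. rewrite Rmult_assoc, Rinv_l by nra. lra. }
  apply Rabs_def2 in Hk. unfold Rdiv in *. lra.
Qed.

Lemma stage_floor_close V k P Q : (1 <= P)%nat -> (1 <= Q)%nat ->
  stage V k (INR P / INR Q) - / INR (S k) <=
  INR (stage_floor V (S k * S k) k P Q) / (INR (S k) * INR (S k)).
Proof.
  intros HP HQ. destruct (stage_floor_spec V (S k * S k) k P Q HP HQ) as [_ Hs].
  rewrite mult_INR in Hs. assert (Hk1 : 0 < INR (S k)) by (apply lt_0_INR; lia).
  assert (Hkk : INR k <= INR (S k)) by (rewrite S_INR; lra).
  apply Rmult_le_reg_r with (INR (S k) * INR (S k)); [nra|].
  unfold Rdiv at 2. rewrite (Rmult_assoc (INR _)), Rinv_l by nra.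
  replace ((stage V k (INR P / INR Q) - / INR (S k)) * (INR (S k) * INR (S k)))
    with (INR (S k) * INR (S k) * stage V k (INR P / INR Q) - INR (S k)) by (field; lra).
  lra.
Qed.

Lemma exceeds_complete V T num den P Q : optimal V -> 0 < T < 1 ->
  approximates (Theta V T) num den -> (1 <= P)%nat -> (1 <= Q)%nat ->
  T < INR P / INR Q <= 1 ->
  exists k0, forall k, (k0 <= k)%nat -> exceeds V num den k P Q = true.
Proof.
  intros HV HT Ha HP HQ Ht. set (t := INR P / INR Q) in *.
  destruct (compressible_exists V HV) as [x Hx].
  destruct (in_stage_complete V x Hx) as [k1 Hk1].
  set (d := pw (len x) T * ln 2 * (t - T)).
  assert (Hd : 0 < d).
  { pose proof (pw_pos (len x) T). pose proof ln2_pos. unfold d.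
    apply Rmult_lt_0_compat; [nra|lra]. }
  destruct (stage_close V T (d / 2) HT ltac:(lra)) as [k2 Hk2].
  (* The missed strings take half of the gap [d]. Three errors of [1/(k+1)] must fit into the other
     half: the approximation of [Theta], the margin in [exceeds], and the floors. *)
  destruct (exists_nat_inv (d / 6) ltac:(lra)) as [k3 Hk3].
  exists (k1 + k2 + k3)%nat. intros k Hk.
  destruct (Ha k) as [Hden Hk4]. apply exceeds_iff; auto.
  apply Rlt_le_trans with (2 := stage_floor_close V k P Q HP HQ). fold t.
  pose proof (stage_slope_low V k x T t (Hk1 k ltac:(lia)) ltac:(lra) ltac:(lra)) as H1.
  fold d in H1. specialize (Hk2 k ltac:(lia)). specialize (Hk3 k ltac:(lia)).
  apply Rabs_def2 in Hk4. unfold Rdiv at 2 4 in Hk4. rewrite Rmult_1_l in Hk4.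
  lra.
Qed.

(* [z] encodes a stage [k] and a string [x]. *)
Definition random_test (V : mrec) (num den : nat -> nat) (c y z : nat) : bool :=
  exceeds V num den (cfst z) (S (S y - 2 ^ len y)) (2 ^ len y) &&
  negb (in_stage V (cfst z) (csnd z)) &&
  ((len (csnd z) + c + 1) * 2 ^ len y <=? len y * (S y - 2 ^ len y))%nat &&
  (len y * (S y - 2 ^ len y) <? (len (csnd z) + c + 2) * 2 ^ len y)%nat.

Lemma random_test_rec V num den c : rec1 num -> rec1 den ->
  recb 2 (fun v => random_test V num den c (hd 0%nat v) (hd 0%nat (tl v))).
Proof.
  intros Hnum Hden. unfold random_test, exceeds.
  assert (Hn : rec 2 (fun v => num (cfst (hd 0%nat (tl v)))))
    by (apply (rec1_app num); auto; rec_solve).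
  assert (Hd : rec 2 (fun v => den (cfst (hd 0%nat (tl v)))))
    by (apply (rec1_app den); auto; rec_solve).
  repeat apply recb_andb; try solve [rec_solve].
  - apply recb_ltb; [rec_solve|]. apply rec_mul; auto.
    apply (rec_stage_floor V 2
      (fun v => S (cfst (hd 0 (tl v))) * S (cfst (hd 0 (tl v))))%nat
      (fun v => cfst (hd 0%nat (tl v)))
      (fun v => S (S (hd 0%nat v) - 2 ^ len (hd 0%nat v)))
      (fun v => 2 ^ len (hd 0 v))%nat); rec_solve.
  - apply recb_negb. apply recb_in_stage; rec_solve.
Qed.

Lemma nat_over_pow2 n : INR n <= 2 ^ n.
Proof.
  rewrite <- two_pow_INR. apply le_INR. pose proof (Nat.pow_gt_lin_r 2 n ltac:(lia)). lia.
Qed.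

(** Put [v = floor(T 2^n)] and [t = (v+1)/2^n]. The test fixes the length of the string as
    [floor(n v/2^n) - c - 1], which is at most [T n - c - 1]. A compressible string outside the
    stage would have weight below [C 2^-n], hence length above [T n - c]. Rounding loses
    [n/2^n <= 1] and less than 1 more, whence the total loss [c + 3]. *)
Lemma random_test_spec V T num den : optimal V -> 0 < T < 1 ->
  approximates (Theta V T) num den ->
  exists c n0, forall n y, (n0 <= n)%nat -> S y = (2 ^ n + bin_floor T n)%nat ->
    (exists z, random_test V num den c y z = true) /\
    (forall z, random_test V num den c y z = true ->
       ~ compressible V (csnd z) /\ T * INR n - INR (c + 3) <= INR (len (csnd z))).
Proof.
  intros HV HT Ha. set (t0 := (1 + T) / 2).
  destruct (stage_slope_up V T t0) as [C [HC Hslope]]; [unfold t0; lra|unfold t0; lra|].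
  destruct (exists_pow2_ge C) as [c Hc].
  destruct (exists_pow2_small (t0 - T)) as [n1 Hn1]; [unfold t0; lra|].
  (* From [c + 3 <= T n] it follows that [floor(n v/2^n) >= c + 1], so the prescribed length is a
     natural number. *)
  destruct (exists_nat_ge (INR (c + 3) / T)) as [n2 Hn2].
  exists c, (n1 + n2)%nat. intros n y Hn Hy.
  set (v := bin_floor T n) in *. pose proof (bin_floor_spec T n HT) as Hv. fold v in Hv.
  assert (P2 : 0 < 2 ^ n) by (apply pow_lt; lra).
  assert (Hv2 : (v < 2 ^ n)%nat) by (apply INR_lt; rewrite two_pow_INR; nra).
  assert (El : len y = n) by (apply len_unique; rewrite Nat.pow_succ_r'; lia).
  assert (Ev : (S y - 2 ^ n = v)%nat) by lia.
  pose proof (nat_over_pow2 n) as Hn2n.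
  set (t := INR (S v) / INR (2 ^ n)).
  assert (Ht2 : t * 2 ^ n = INR v + 1).
  { unfold t. rewrite two_pow_INR, S_INR. field. lra. }
  assert (Hi : / 2 ^ n * 2 ^ n = 1) by (apply Rinv_l; lra).
  assert (HTt : T < t) by nra.
  assert (Htn : t <= T + / 2 ^ n) by nra.
  specialize (Hn1 n ltac:(lia)).
  assert (Ht0 : t <= t0) by lra.
  assert (HnT : INR (c + 3) <= T * INR n).
  { assert (INR n2 <= INR n) by (apply le_INR; lia).
    apply Rle_trans with (T * INR n2); [|nra].
    apply Rmult_le_compat_l with (r := T) in Hn2; [|lra].
    replace (T * (INR (c + 3) / T)) with (INR (c + 3)) in Hn2 by (field; lra). lra. }
  assert (HQ : (1 <= 2 ^ n)%nat) by (pose proof (two_pow_pos n); lia).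
  unfold random_test. rewrite El, Ev. split.
  - destruct (exceeds_complete V T num den (S v) (2 ^ n) HV HT Ha) as [k Hk];
      [lia|auto|fold t; unfold t0 in Ht0; lra|].
    set (h := (n * v / 2 ^ n)%nat).
    pose proof (Nat.div_mod (n * v) (2 ^ n) ltac:(lia)) as Hdiv. fold h in Hdiv.
    pose proof (Nat.mod_upper_bound (n * v) (2 ^ n) ltac:(lia)) as Hmod.
    assert (Hh : (c + 1 <= h)%nat).
    { apply Nat.div_le_lower_bound; [lia|]. apply INR_le.
      rewrite !mult_INR, two_pow_INR, plus_INR. rewrite plus_INR in HnT.
      replace (INR 3) with 3 in HnT by (simpl; lra). change (INR 1) with 1.
      pose proof (pos_INR n).
      assert (INR n * (T * 2 ^ n - 1) <= INR n * INR v) by (apply Rmult_le_compat_l; lra).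
      nra. }
    (* An incompressible string belongs to no stage, so a string of the prescribed length passes the
       test. *)
    destruct (incompressible V (h - c - 1)) as [x [Hx HxW]].
    destruct (unpair_surj k x) as [z [Hz1 Hz2]]. exists z. rewrite Hz1, Hz2, Hx.
    rewrite Hk by auto. rewrite !Bool.andb_true_iff, Nat.leb_le, Nat.ltb_lt.
    replace (h - c - 1 + c + 1)%nat with h by lia.
    replace (h - c - 1 + c + 2)%nat with (S h) by lia.
    repeat split; auto; [|nia|nia].
    destruct (in_stage V k x) eqn:E; auto. apply in_stage_sound in E. tauto.
  - intros z H. rewrite !Bool.andb_true_iff, Nat.leb_le, Nat.ltb_lt in H.
    destruct H as [[[Hex Hnw] Hlo] Hhi]. set (x := csnd z) in *. set (k := cfst z) in *.
    apply (exceeds_sound V (Theta V T)) in Hex; auto; [|lia]. fold t in Hex.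
    apply le_INR in Hlo. apply lt_INR in Hhi.
    rewrite !mult_INR, !plus_INR, two_pow_INR in Hlo, Hhi.
    change (INR 2) with 2 in *. change (INR 1) with 1 in *. pose proof (pos_INR n) as Hn0.
    split.
    + intros Hw. apply Bool.negb_true_iff in Hnw.
      pose proof (stage_missed V k T x HT Hw Hnw) as Hm.
      pose proof (Hslope k t ltac:(lra)) as Hs.
      assert (Hpw : pw (len x) T < C * / 2 ^ n) by nra.
      apply (pw_missed _ _ _ c _ HT Hc) in Hpw.
      assert (INR n * INR v <= INR n * (T * 2 ^ n)) by (apply Rmult_le_compat_l; lra).
      assert ((INR (len x) + INR c + 1) * 2 ^ n <= (INR n * T) * 2 ^ n) by lra.
      apply Rmult_le_reg_r in H0; auto. lra.
    + rewrite plus_INR. replace (INR 3) with 3 by (simpl; lra).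
      assert (INR n * (T * 2 ^ n - 1) <= INR n * INR v) by (apply Rmult_le_compat_l; lra).
      assert ((INR n * T) * 2 ^ n < (INR (len x) + INR c + 3) * 2 ^ n) by lra.
      apply Rmult_lt_reg_r in H0; auto. lra.
Qed.

(** A program of [U] for [T|n] becomes, through the search, a program of [M] for an incompressible
    string [s] with [|s| >= T n - O(1)]. Optimality of [V] turns it into a program for [s] longer by
    at most a constant, and that program is at least as long as [s]. *)
Lemma Theta_weakly_random U V T : optimal U -> optimal V -> 0 < T < 1 ->
  computable_real (Theta V T) -> weakly_Chaitin_random U T T.
Proof.
  intros [HU _] HV HT Hcomp.
  assert (H0 : 0 <= Theta V T) by apply (weight_sum_le_Theta V T 0 HT).
  destruct (computable_approx _ H0 Hcomp) as [num [den [Hnum [Hden Ha]]]].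
  destruct (random_test_spec V T num den HV HT Ha) as [c [n0 Hspec]].
  destruct (search_machine (random_test V num den c) (fun _ z => csnd z)) as [e He].
  { apply random_test_rec; auto. }
  { unfold rec2. rec_solve. }
  set (M := MComp e [U]).
  assert (HM : forall p s, run M p s -> exists t, run U p t /\ eval e [enc t] (enc s)).
  { intros p s H. inversion H as [| | |? ? ? ws ? Hws He'| | |]; subst.
    inversion Hws as [|? ? ? y ws1 Hy Hws1]; subst. inversion Hws1; subst.
    destruct (enc_surj y) as [t <-]. exists t. auto. }
  destruct HV as [HVpf HV]. destruct (HV M) as [d Hd].
  { intros p q s t Hp Hq. apply HM in Hp as [a [Hp _]]. apply HM in Hq as [b [Hq _]].
    eapply HU; eauto. }
  (* The summand [n0] makes the bound trivial for [n < n0], as [T n < n0]. *)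
  exists (c + 3 + d + n0)%nat. intros n Hn. apply HC_ge. intros p Hp.
  rewrite !plus_INR. pose proof (pos_INR (length p)). pose proof (pos_INR n).
  destruct (Nat.le_gt_cases n0 n) as [Hle|Hgt].
  - destruct (Hspec n (enc (restr T n)) Hle (enc_restr T n HT)) as [Hex Hsound].
    destruct (least_exists _ Hex) as [z Hz].
    destruct (Hsound z (proj1 Hz)) as [HnW Hlen].
    destruct (enc_surj (csnd z)) as [s Hs]. rewrite <- Hs in HnW, Hlen.
    assert (Hx : eval e [enc (restr T n)] (enc s)) by (apply He; eauto).
    destruct (Hd p s) as [q [Hq Hl]].
    { apply ev_comp with [enc (restr T n)]; [|exact Hx].
      constructor; [exact Hp|constructor]. }
    rewrite len_enc in Hlen.
    assert (Hqs : (length s <= length q)%nat).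
    { apply Nat.nlt_ge. intros Hlt. apply HnW, compressible_enc. eauto. }
    apply (Nat.le_trans _ _ _ Hqs) in Hl. apply le_INR in Hl.
    rewrite plus_INR in Hl, Hlen. pose proof (pos_INR n0). lra.
  - apply lt_INR in Hgt. pose proof (pos_INR c). pose proof (pos_INR d).
    pose proof (pos_INR 3). nra.
Qed.

(** * Compressibility *)

(* [below] and [above] certify [stage V k (P/Q) < theta] and [theta < stage V k (P/Q)]
   with precision [1/(q+1)]. *)
Definition below (V : mrec) (num den : nat -> nat) (q k P Q : nat) : bool :=
  ((stage_floor V (S q) k P Q + k + 1) * den q <? num q * S q)%nat.

Definition above (V : mrec) (num den : nat -> nat) (q k P Q : nat) : bool :=
  (num q * S q + den q <? stage_floor V (S q) k P Q * den q)%nat.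

Lemma frac_lt a b c d : 0 < b -> 0 < d -> a / b < c / d <-> a * d < c * b.
Proof.
  intros Hb Hd.
  replace (a * d) with (a / b * (b * d)) by (field; lra).
  replace (c * b) with (c / d * (b * d)) by (field; lra).
  assert (0 < b * d) by (apply Rmult_lt_0_compat; auto).
  split; intros H1; [apply Rmult_lt_compat_r|apply Rmult_lt_reg_r in H1]; auto.
Qed.

Lemma below_iff V num den q k P Q : (0 < den q)%nat ->
  below V num den q k P Q = true <->
  (INR (stage_floor V (S q) k P Q) + INR k + 1) / INR (S q) < INR (num q) / INR (den q).
Proof.
  intros Hd. unfold below. rewrite Nat.ltb_lt, frac_lt by (apply lt_0_INR; lia).
  change 1 with (INR 1). rewrite <- !plus_INR, <- !mult_INR.
  split; [apply lt_INR|apply INR_lt].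
Qed.

Lemma above_iff V num den q k P Q : (0 < den q)%nat ->
  above V num den q k P Q = true <->
  INR (num q) / INR (den q) + / INR (S q) < INR (stage_floor V (S q) k P Q) / INR (S q).
Proof.
  intros Hd. unfold above. rewrite Nat.ltb_lt.
  assert (H1 : 0 < INR (S q)) by (apply lt_0_INR; lia). apply lt_0_INR in Hd.
  replace (INR (num q) / INR (den q) + / INR (S q))
    with ((INR (num q) * INR (S q) + INR (den q)) / (INR (den q) * INR (S q)))
    by (field; lra).
  rewrite frac_lt by (auto; apply Rmult_lt_0_compat; auto).
  rewrite (Rmult_comm (INR (den q))), (Rmult_comm _ (INR (S q))), <- !Rmult_assoc.
  rewrite (Rmult_comm (INR (S q))), (Rmult_assoc _ (INR (S q))),
    (Rmult_comm (INR (S q)) (INR (den q))), <- Rmult_assoc.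
  rewrite <- !mult_INR, <- plus_INR, <- !mult_INR. split.
  - intros H. apply lt_INR. nia.
  - intros H. apply INR_lt in H. nia.
Qed.

Lemma stage_floor_div V q k P Q : (1 <= P)%nat -> (1 <= Q)%nat ->
  let a := INR (stage_floor V (S q) k P Q) / INR (S q) in
  a <= stage V k (INR P / INR Q) <= a + INR k * / INR (S q).
Proof.
  intros HP HQ a. destruct (stage_floor_spec V (S q) k P Q HP HQ) as [H1 H2].
  assert (Hq : 0 < INR (S q)) by (apply lt_0_INR; lia).
  split; apply Rmult_le_reg_l with (INR (S q)); auto; unfold a.
  - replace (INR (S q) * (INR (stage_floor V (S q) k P Q) / INR (S q)))
      with (INR (stage_floor V (S q) k P Q)) by (field; lra). auto.
  - replace (INR (S q) * (INR (stage_floor V (S q) k P Q) / INR (S q) + INR k * / INR (S q)))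
      with (INR (stage_floor V (S q) k P Q) + INR k) by (field; lra). auto.
Qed.

Lemma below_sound V theta num den q k P Q :
  approximates theta num den -> (1 <= P)%nat -> (1 <= Q)%nat ->
  below V num den q k P Q = true -> stage V k (INR P / INR Q) < theta.
Proof.
  intros Ha HP HQ H. destruct (Ha q) as [Hd Hq]. apply below_iff in H; auto.
  pose proof (stage_floor_div V q k P Q HP HQ) as [_ Hs].
  apply Rabs_def2 in Hq. unfold Rdiv in *. lra.
Qed.

Lemma above_sound V theta num den q k P Q :
  approximates theta num den -> (1 <= P)%nat -> (1 <= Q)%nat ->
  above V num den q k P Q = true -> theta < stage V k (INR P / INR Q).
Proof.
  intros Ha HP HQ H. destruct (Ha q) as [Hd Hq]. apply above_iff in H; auto.
  pose proof (stage_floor_div V q k P Q HP HQ) as [Hs _].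
  apply Rabs_def2 in Hq. unfold Rdiv in *. lra.
Qed.

(** The stage is fixed here and only the precision [q] grows. Strict inequalities at a fixed stage
    have a positive gap, so they are certified eventually. *)
Lemma sandwich_complete V theta num den k P1 P2 Q :
  approximates theta num den -> (1 <= P1)%nat -> (1 <= P2)%nat -> (1 <= Q)%nat ->
  stage V k (INR P1 / INR Q) < theta < stage V k (INR P2 / INR Q) ->
  exists q, below V num den q k P1 Q = true /\ above V num den q k P2 Q = true.
Proof.
  intros Ha H1 H2 HQ [Hlo Hhi].
  set (g := Rmin (theta - stage V k (INR P1 / INR Q)) (stage V k (INR P2 / INR Q) - theta)).
  assert (Hg : 0 < g) by (apply Rmin_glb_lt; lra).
  pose proof (pos_INR k) as Hk.
  (* In units of [1/(q+1)]: the floors cost at most [k], the approximation of [theta] and the margin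
     in the test cost 1 each. *)
  destruct (exists_nat_inv (g / (INR k + 2))) as [q Hq]; [apply Rdiv_lt_0_compat; lra|].
  exists q. specialize (Hq q (le_n q)). destruct (Ha q) as [Hd Hqa].
  assert (Hgk : (INR k + 2) * / INR (S q) < g).
  { apply Rmult_lt_compat_l with (r := INR k + 2) in Hq; [|lra].
    replace ((INR k + 2) * (g / (INR k + 2))) with g in Hq by (field; lra). auto. }
  assert (Hg1 : g <= theta - stage V k (INR P1 / INR Q)) by apply Rmin_l.
  assert (Hg2 : g <= stage V k (INR P2 / INR Q) - theta) by apply Rmin_r.
  apply Rabs_def2 in Hqa.
  pose proof (stage_floor_div V q k P1 Q H1 HQ) as [Hs1 _].
  pose proof (stage_floor_div V q k P2 Q H2 HQ) as [_ Hs2].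
  split.
  - apply below_iff; auto. unfold Rdiv in *. lra.
  - apply above_iff; auto. unfold Rdiv in *. lra.
Qed.

(* Certifies [(b - 1)/2^m < stage V k (P/Q)] with precision [1/(k+1)]. *)
Definition reached (V : mrec) (k P Q b m : nat) : bool :=
  (b * (S k * S k) <? stage_floor V (S k * S k) k P Q * 2 ^ m + S k * S k)%nat.

Lemma reached_iff V k P Q b m :
  reached V k P Q b m = true <->
  (INR b - 1) / 2 ^ m < INR (stage_floor V (S k * S k) k P Q) / (INR (S k) * INR (S k)).
Proof.
  unfold reached. rewrite Nat.ltb_lt.
  assert (Hk : 0 < INR (S k)) by (apply lt_0_INR; lia).
  rewrite frac_lt; [|apply pow_lt; lra|apply Rmult_lt_0_compat; auto].
  rewrite <- two_pow_INR, <- (mult_INR (S k)), Rmult_minus_distr_r, Rmult_1_l.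
  split; intros H.
  - apply lt_INR in H. rewrite plus_INR, !mult_INR in *. lra.
  - apply INR_lt. rewrite plus_INR, !mult_INR in *. lra.
Qed.

(** At temperature [T] the missing part is at most [2^((1 - L j) r/T)]. Since [L r/T > K], its
    exponent outruns that of [2^-(K j + i)] linearly in [j]. For large [j] the missing part at [r]
    is also too small to omit the fixed string [x]. *)
Lemma compress_sound V T r L K x c : 0 < T < r -> r < 1 -> (1 <= L)%nat -> (1 <= K)%nat ->
  INR K < INR L * (r / T) -> compressible V x -> 0 < c ->
  exists j0, forall j i k, (j0 <= j)%nat -> (i < K)%nat ->
    Theta V r - stage V k r <= 2 * / 2 ^ (L * j) ->
    in_stage V k x = true /\ Theta V T - stage V k T < c * / 2 ^ (K * j + i).
Proof.
  intros HT Hr HL HK HLK Hx Hc.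
  set (g := INR L * (r / T) - INR K). assert (Hg : 0 < g) by (unfold g; lra).
  destruct (exists_pow2_small (pw (len x) r / 2)) as [j1 Hj1];
    [pose proof (pw_pos (len x) r); lra|].
  destruct (exists_pow2_small c Hc) as [E HE]. specialize (HE E (le_n E)).
  (* The surplus exponent [g j] must pay for the factor 2 (raised to [r/T]), the residue [i < K],
     and the constant [c > 2^-E]. *)
  destruct (exists_nat_ge ((r / T + INR K + INR E) / g)) as [j2 Hj2].
  exists (j1 + j2)%nat. intros j i k Hj Hi Hk. split.
  - destruct (in_stage V k x) eqn:Ex; auto. exfalso.
    pose proof (stage_missed V k r x ltac:(lra) Hx Ex) as H.
    specialize (Hj1 (L * j)%nat ltac:(nia)). lra.
  - apply Rle_lt_trans with (Rpower (2 * / 2 ^ (L * j)) (r / T)).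
    { apply stage_tail; auto.
      apply Rmult_lt_0_compat; [lra|apply Rinv_0_lt_compat, pow_lt; lra]. }
    assert (E1 : 2 * / 2 ^ (L * j) = Rpower 2 (1 - INR (L * j))).
    { unfold Rminus. rewrite Rpower_plus, Rpower_1, Rpower_Ropp, Rpower_pow by lra. auto. }
    rewrite E1, Rpower_mult.
    assert (E2 : / 2 ^ E * / 2 ^ (K * j + i) = Rpower 2 (- INR E - INR (K * j + i))).
    { unfold Rminus. rewrite Rpower_plus, !Rpower_Ropp, !Rpower_pow by lra. auto. }
    apply Rle_lt_trans with (/ 2 ^ E * / 2 ^ (K * j + i)).
    + rewrite E2. apply Rle_Rpower; [lra|]. rewrite plus_INR, !mult_INR.
      assert (Hi' : INR i <= INR K) by (apply le_INR; lia).
      assert (H2 : r / T + INR K + INR E <= INR j * g).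
      { apply Rmult_le_compat_r with (r := g) in Hj2; [|lra].
        unfold Rdiv at 1 in Hj2. rewrite Rmult_assoc, Rinv_l in Hj2 by lra.
        assert (INR j2 <= INR j) by (apply le_INR; lia). nra. }
      unfold g in H2. lra.
    + apply Rmult_lt_compat_r; auto. apply Rinv_0_lt_compat, pow_lt; lra.
Qed.

(* [z] encodes [(j, (b, (k, (u, q))))]; at stage [k] the equation for [T] is located
   between [u/2^n] and [(u+3)/2^n], where [n = K * j + i]. *)
Definition compress_test V num den L c P Q K i y z : bool :=
  let j := cfst z in let b := cfst (csnd z) in let k := cfst (csnd (csnd z)) in
  let u := cfst (csnd (csnd (csnd z))) in
  let q := csnd (csnd (csnd (csnd z))) in
  header_code L c y j b && reached V k P Q b (L * j) && (1 <=? u)%nat &&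
  below V num den q k u (2 ^ (K * j + i)) &&
  above V num den q k (u + 3) (2 ^ (K * j + i)).

(** With [n = K j + i] this is [2^n + u], one more than the code of the [n]-bit string of value [u]
    when [u < 2^n]. *)
Definition compress_value K i z : nat :=
  (2 ^ (K * cfst z + i) + cfst (csnd (csnd (csnd z))))%nat.

Lemma compress_test_rec V num den L c P Q K i : rec1 num -> rec1 den ->
  recb 2 (fun v => compress_test V num den L c P Q K i (hd 0%nat v) (hd 0%nat (tl v))).
Proof.
  intros Hnum Hden. unfold compress_test, below, above, reached, header_code.
  set (h := fun v : list nat => csnd (csnd (csnd (csnd (hd 0%nat (tl v)))))).
  assert (Hn : rec 2 (fun v => num (h v))) by (apply (rec1_app num); auto; unfold h; rec_solve).
  assert (Hd : rec 2 (fun v => den (h v))) by (apply (rec1_app den); auto; unfold h; rec_solve).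
  assert (Hs : forall N k P Q : list nat -> nat, rec 2 N -> rec 2 k -> rec 2 P -> rec 2 Q ->
    rec 2 (fun v => stage_floor V (N v) (k v) (P v) (Q v)))
    by (intros; apply rec_stage_floor; auto).
  unfold h in *.
  repeat apply recb_andb; try solve [rec_solve].
  - apply recb_ltb; [rec_solve|]. apply rec_add; [|rec_solve].
    apply rec_mul; [|rec_solve].
    apply (Hs (fun v => S (cfst (csnd (csnd (hd 0 (tl v)))))
        * S (cfst (csnd (csnd (hd 0 (tl v))))))%nat
      (fun v => cfst (csnd (csnd (hd 0%nat (tl v))))) (fun _ => P) (fun _ => Q)); rec_solve.
  - apply recb_ltb; [|apply rec_mul; auto; rec_solve].
    apply rec_mul; auto. do 2 (apply rec_add; [|rec_solve]).
    apply (Hs (fun v => S (csnd (csnd (csnd (csnd (hd 0 (tl v)))))))%nat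
      (fun v => cfst (csnd (csnd (hd 0%nat (tl v)))))
      (fun v => cfst (csnd (csnd (csnd (hd 0%nat (tl v))))))
      (fun v => 2 ^ (K * cfst (hd 0 (tl v)) + i))%nat); rec_solve.
  - apply recb_ltb; [apply rec_add; auto; apply rec_mul; auto; rec_solve|].
    apply rec_mul; auto.
    apply (Hs (fun v => S (csnd (csnd (csnd (csnd (hd 0 (tl v)))))))%nat
      (fun v => cfst (csnd (csnd (hd 0%nat (tl v)))))
      (fun v => cfst (csnd (csnd (csnd (hd 0 (tl v))))) + 3)%nat
      (fun v => 2 ^ (K * cfst (hd 0 (tl v)) + i))%nat); rec_solve.
Qed.

(** For each [i] and [a] there is a machine with output code [2^n + u + a - 2], that of the [n]-bit
    string of value [u + a - 1] when this value is in range. The conclusion is stated for all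
    [d' >= d] so that the constants of finitely many machines can be merged. *)
Lemma compress_cost U V num den L c P Q K i a : optimal U -> rec1 num -> rec1 den ->
  exists d, forall d', (d <= d')%nat -> forall p z s,
    least (compress_test V num den L c P Q K i (enc p)) z ->
    (enc s = compress_value K i z + a - 2)%nat ->
    exists q, run U q s /\ (length q <= length p + d')%nat.
Proof.
  intros [_ HU] Hnum Hden.
  destruct (search_machine (compress_test V num den L c P Q K i)
    (fun _ z => compress_value K i z + a - 2)%nat) as [e He].
  { apply compress_test_rec; auto. }
  { unfold rec2, compress_value. rec_solve. }
  destruct (HU e) as [d Hd].
  { apply (header_prefix_free e L c). intros p s Hp. apply He in Hp as [z [[Hz _] _]].
    unfold compress_test in Hz. rewrite !Bool.andb_true_iff in Hz.
    destruct Hz as [[[[Hz _] _] _] _]. apply header_code_iff in Hz as [w [? [? _]]]. eauto. }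
  exists d. intros d' Hd' p z s Hz Hs. destruct (Hd p s) as [q [Hq Hl]].
  - apply He. eauto.
  - exists q. split; auto. lia.
Qed.

(** At a stage passing [reached], [stage V k T <= Theta V T < stage V k (T + 2^-n)], so the solution
    of the equation lies between [T] and [T + 2^-n]. With [v = floor(T 2^n)], the test [below] at
    [u] forces [u <= v + 1], and [above] at [u + 3] forces [v < u + 3]; hence [v + 1 - u] is one of
    0, 1, 2, 3. *)
Lemma compress_test_spec V T num den P Q L c K : optimal V -> 0 < T ->
  (1 <= P)%nat -> (1 <= Q)%nat -> T < INR P / INR Q < 1 -> (1 <= L)%nat -> (1 <= K)%nat ->
  INR K < INR L * (INR P / INR Q / T) -> Theta V (INR P / INR Q) < 2 ^ c ->
  approximates (Theta V T) num den ->
  exists j0, forall j i, (j0 <= j)%nat -> (i < K)%nat -> exists w,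
    length w = (L * j + c)%nat /\
    (exists z, compress_test V num den L c P Q K i (enc (header j w)) z = true) /\
    (forall z, compress_test V num den L c P Q K i (enc (header j w)) z = true ->
      exists a, (a < 4)%nat /\
        (2 ^ (K * j + i) + bin_floor T (K * j + i) + 1 = compress_value K i z + a)%nat).
Proof.
  intros HV HT0 HP HQ Hr HL HK HLK Hc Ha. set (r := INR P / INR Q) in *.
  destruct (compressible_exists V HV) as [x Hx].
  set (s0 := pw (len x) T * ln 2).
  assert (Hs0 : 0 < s0) by (apply Rmult_lt_0_compat; [apply pw_pos|apply ln2_pos]).
  destruct (compress_sound V T r L K x s0 ltac:(lra) ltac:(lra) HL HK HLK Hx Hs0)
    as [j1 Hj1].
  (* The first condition keeps [T + 2^-n] below 1; the second gives [v >= 2], so that [u = v - 1] is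
     a positive numerator. *)
  destruct (exists_pow2_small (1 - T) ltac:(lra)) as [j2 Hj2].
  destruct (exists_pow2_small (T / 2) ltac:(lra)) as [j3 Hj3].
  exists (j1 + j2 + j3)%nat. intros j i Hj Hi.
  set (n := (K * j + i)%nat). assert (Hnj : (j <= n)%nat) by (unfold n; nia).
  specialize (Hj2 n ltac:(lia)). specialize (Hj3 n ltac:(lia)).
  assert (HT : 0 < T < 1) by lra. assert (Hr01 : 0 < r < 1) by lra.
  assert (Hth : 0 <= Theta V r) by apply (weight_sum_le_Theta V r 0 Hr01).
  set (m := (L * j)%nat). assert (Pm : 0 < 2 ^ m) by (apply pow_lt; lra).
  assert (Pn : 0 < 2 ^ n) by (apply pow_lt; lra).
  assert (Hin : / 2 ^ n * 2 ^ n = 1) by (apply Rinv_l; lra).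
  assert (Him : / 2 ^ m * 2 ^ m = 1) by (apply Rinv_l; lra).
  (* The input word holds [m] bits of the fractional part of [Theta V r] and [c] bits for its
     integer part, which is below [2^c]. *)
  destruct (nfloor_ex (Theta V r * 2 ^ m)) as [b Hb]; [nra|].
  assert (Hbm : (b < 2 ^ (m + c))%nat).
  { apply INR_lt. rewrite two_pow_INR, pow_add. nra. }
  destruct (val_surj _ _ Hbm) as [w [Hw Hwv]]. exists w. split; auto.
  set (v := bin_floor T n). pose proof (bin_floor_spec T n HT) as Hv. fold v in Hv.
  assert (HQn : (1 <= 2 ^ n)%nat) by (pose proof (two_pow_pos n); lia).
  set (Tn := T + / 2 ^ n).
  assert (Hi2 : 0 < / 2 ^ n) by (apply Rinv_0_lt_compat; auto).
  (* Raising the temperature by [2^-n] adds at least [s0 2^-n] through the string [x], more than the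
     stage misses at [T]. *)
  assert (Hgap : forall k, Theta V r - stage V k r <= 2 * / 2 ^ m ->
    in_stage V k x = true /\ Theta V T < stage V k Tn).
  { intros k Hk. destruct (Hj1 j i k ltac:(lia) Hi Hk) as [Hxk Ht]. split; auto.
    pose proof (stage_slope_low V k x T Tn Hxk ltac:(unfold Tn; lra) ltac:(unfold Tn; lra)) as H.
    fold s0 n in H, Ht. replace (Tn - T) with (/ 2 ^ n) in H by (unfold Tn; ring). lra. }
  split.
  (* Half of [2^-m] is granted to the missed strings, half to the rounding in [reached]; the offset
     in [(b - 1)/2^m] makes room for both. *)
  - destruct (stage_close V r (/ 2 ^ m / 2) Hr01) as [k1 Hk1].
    { pose proof (Rinv_0_lt_compat _ Pm). lra. }
    destruct (exists_nat_inv (/ 2 ^ m / 2)) as [k2 Hk2].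
    { pose proof (Rinv_0_lt_compat _ Pm). lra. }
    set (k := (k1 + k2)%nat). specialize (Hk1 k ltac:(lia)). specialize (Hk2 k ltac:(lia)).
    assert (Hreach : reached V k P Q b m = true).
    { apply reached_iff. apply Rlt_le_trans with (2 := stage_floor_close V k P Q HP HQ).
      fold r. assert ((INR b - 1) / 2 ^ m <= Theta V r - / 2 ^ m); [|lra].
      apply Rmult_le_reg_r with (2 ^ m); auto. unfold Rdiv.
      rewrite Rmult_assoc, Him, Rmult_1_r, Rmult_minus_distr_r, Him. lra. }
    destruct (Hgap k) as [Hxk Hup]; [pose proof (Rinv_0_lt_compat _ Pm); lra|].
    assert (Hv2 : (2 <= v)%nat).
    { apply INR_le. assert (1 < INR v); [nra|]. change (INR 2) with 2.
      assert (1 < v)%nat by (apply INR_lt; change (INR 1) with 1; auto).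
      apply le_INR in H0. change (INR 2) with 2 in H0. auto. }
    assert (Hv1 : INR (v - 1) = INR v - 1) by (rewrite minus_INR by lia; auto).
    (* The choice [u = v - 1] puts [u/2^n] strictly below [T] even when [T = v/2^n], while
       [(v+2)/2^n] is at least [T + 2^-n]. This is why the window has width 3. *)
    destruct (sandwich_complete V (Theta V T) num den k (v - 1) (v - 1 + 3) (2 ^ n) Ha)
      as [q [Hq1 Hq2]]; try lia.
    { rewrite plus_INR, Hv1, two_pow_INR. replace (INR 3) with 3 by (simpl; lra). split.
      - set (t := (INR v - 1) / 2 ^ n).
        assert (Ht : t * 2 ^ n = INR v - 1) by (unfold t; field; lra).
        assert (1 <= INR v - 1).
        { rewrite <- Hv1. apply INR_ge1. lia. }
        pose proof (stage_slope_low V k x t T Hxk) as H1.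
        assert (Ht0 : 0 < t) by nra. assert (HtT : t < T) by nra.
        specialize (H1 ltac:(lra) ltac:(lra)).
        pose proof (pw_pos (len x) t). pose proof ln2_pos.
        assert (0 < pw (len x) t * ln 2 * (T - t)).
        { apply Rmult_lt_0_compat; [|lra]. apply Rmult_lt_0_compat; auto. }
        pose proof (stage_le_Theta V k T HT). lra.
      - apply Rlt_le_trans with (1 := Hup). apply stage_mono.
        split; [unfold Tn; lra|]. apply Rmult_le_reg_r with (2 ^ n); auto.
        unfold Tn, Rdiv. rewrite Rmult_assoc, Hin, Rmult_plus_distr_r, Hin. lra. }
    destruct (unpair_surj (v - 1) q) as [z3 [E1 E2]].
    destruct (unpair_surj k z3) as [z2 [E3 E4]].
    destruct (unpair_surj b z2) as [z1 [E5 E6]].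
    destruct (unpair_surj j z1) as [z [E7 E8]].
    exists z. unfold compress_test.
    rewrite E7, E8, E5, E6, E3, E4, E1, E2. fold m n.
    rewrite !Bool.andb_true_iff. repeat split; auto.
    + apply header_code_iff. exists w. auto.
    + apply Nat.leb_le. lia.
  - intros z Hz. unfold compress_test in Hz. rewrite !Bool.andb_true_iff in Hz.
    destruct Hz as [[[[Hh Hreach] Hu] Hbel] Habv].
    apply header_code_iff in Hh as [w' [Eh [Hw' Hwv']]].
    destruct (header_inj (cfst z) w' j w []) as [Ej Ew]; [rewrite app_nil_r; auto|].
    rewrite app_nil_r in Ew. subst w'. rewrite <- Ej in *.
    rewrite Hwv in Hwv'. rewrite <- Hwv' in *. fold m n in Hreach, Hbel, Habv.
    unfold compress_value. rewrite <- Ej. fold n.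
    set (k := cfst (csnd (csnd z))) in *.
    set (u := cfst (csnd (csnd (csnd z)))) in *.
    apply Nat.leb_le in Hu.
    apply (below_sound V (Theta V T)) in Hbel; auto.
    apply (above_sound V (Theta V T)) in Habv; auto; [|lia].
    rewrite two_pow_INR in Hbel, Habv.
    apply reached_iff in Hreach.
    destruct (Hgap k) as [Hxk Hup].
    { destruct (stage_floor_spec V (S k * S k) k P Q HP HQ) as [Hs _]. fold r in Hs.
      rewrite mult_INR in Hs. assert (Hk1 : 0 < INR (S k)) by (apply lt_0_INR; lia).
      assert (Hkk : 0 < INR (S k) * INR (S k)) by (apply Rmult_lt_0_compat; auto).
      assert (Hs' : INR (stage_floor V (S k * S k) k P Q) / (INR (S k) * INR (S k)) <=
        stage V k r).
      { apply Rmult_le_reg_r with (1 := Hkk).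
        unfold Rdiv at 1. rewrite Rmult_assoc, Rinv_l by lra. lra. }
      (* The floor [b] loses at most one unit of [2^-m] and the offset [b - 1] another, which
         explains the factor 2. *)
      assert (Theta V r - 2 * / 2 ^ m <= (INR b - 1) / 2 ^ m); [|lra].
      apply Rmult_le_reg_r with (2 ^ m); auto. unfold Rdiv.
      rewrite Rmult_assoc, Him, Rmult_minus_distr_r, Rmult_assoc, Him. lra. }
    assert (Hu1 : (u <= v + 1)%nat).
    { apply Nat.nlt_ge. intros Hlt. apply le_INR in Hlt. rewrite S_INR, plus_INR in Hlt.
      change (INR 1) with 1 in Hlt.
      assert (Htu : Tn <= INR u / 2 ^ n).
      { apply Rmult_le_reg_r with (2 ^ n); auto.
        unfold Tn, Rdiv. rewrite Rmult_assoc, Hin, Rmult_plus_distr_r, Hin. lra. }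
      pose proof (stage_mono V k Tn (INR u / 2 ^ n) ltac:(unfold Tn in *; lra)). lra. }
    assert (Hu2 : (v < u + 3)%nat).
    { apply Nat.nle_gt. intros Hle. apply le_INR in Hle.
      assert (Htu : INR (u + 3) / 2 ^ n <= T).
      { apply Rmult_le_reg_r with (2 ^ n); auto. unfold Rdiv.
        rewrite Rmult_assoc, Hin. lra. }
      assert (Hpos : 0 < INR (u + 3) / 2 ^ n).
      { apply Rdiv_lt_0_compat; auto. apply lt_0_INR. lia. }
      pose proof (stage_mono V k (INR (u + 3) / 2 ^ n) T ltac:(lra)).
      pose proof (stage_le_Theta V k T HT). lra. }
    exists (v + 1 - u)%nat. lia.
Qed.

Lemma exists_fraction lo : 0 < lo < 1 ->
  exists P Q, (1 <= P)%nat /\ (1 <= Q)%nat /\ lo < INR P / INR Q < 1.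
Proof.
  intros H. destruct (exists_nat_inv (1 - lo) ltac:(lra)) as [k Hk].
  specialize (Hk k (le_n k)). assert (HQ : 0 < INR (S k)) by (apply lt_0_INR; lia).
  destruct (nfloor_ex (lo * INR (S k))) as [f Hf]; [nra|].
  exists (S f), (S k). split; [lia|]. split; [lia|]. rewrite (S_INR f).
  assert (E : (INR f + 1) / INR (S k) * INR (S k) = INR f + 1) by (field; lra).
  assert (E2 : / INR (S k) * INR (S k) = 1) by (field; lra).
  split; nra.
Qed.

(** One step in [j] costs one header bit and [L] bits of [Theta V r], and yields [K] digits of [T].
    Take [r] so close to 1 that [T/r < T + eps/2], [K >= 4/eps], and [L = floor(K T/r) + 1]; then [1
    + L <= 2 + K (T + eps/2) <= (T + eps) K]. *)
Lemma compress_rates T eps : 0 < T < 1 -> 0 < eps ->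
  exists P Q L K, (1 <= P)%nat /\ (1 <= Q)%nat /\ (1 <= L)%nat /\ (1 <= K)%nat /\
    T < INR P / INR Q < 1 /\ INR K < INR L * (INR P / INR Q / T) /\
    1 + INR L <= (T + eps) * INR K.
Proof.
  intros HT He.
  assert (Hlo : T / (T + eps / 2) < 1).
  { apply Rmult_lt_reg_r with (T + eps / 2); [lra|]. unfold Rdiv at 1.
    rewrite Rmult_assoc, Rinv_l by lra. lra. }
  destruct (exists_fraction (Rmax T (T / (T + eps / 2)))) as [P [Q [HP [HQ Hr]]]].
  { split; [apply Rlt_le_trans with T; [lra|apply Rmax_l]|apply Rmax_lub_lt; lra]. }
  set (r := INR P / INR Q) in *.
  assert (Hr1 : T < r) by (apply Rle_lt_trans with (2 := proj1 Hr); apply Rmax_l).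
  assert (Hr2 : T / (T + eps / 2) < r) by (apply Rle_lt_trans with (2 := proj1 Hr); apply Rmax_r).
  assert (Hr3 : T / r < T + eps / 2).
  { apply Rmult_lt_compat_r with (r := T + eps / 2) in Hr2; [|lra].
    unfold Rdiv in Hr2 at 1. rewrite Rmult_assoc, Rinv_l, Rmult_1_r in Hr2 by lra.
    apply Rmult_lt_reg_r with r; [lra|]. unfold Rdiv at 1.
    rewrite Rmult_assoc, Rinv_l by lra. lra. }
  destruct (exists_nat_ge (4 / eps)) as [K0 HK0]. set (K := S K0).
  assert (HK : 4 <= eps * INR K).
  { unfold K. rewrite S_INR. apply Rmult_le_compat_l with (r := eps) in HK0; [|lra].
    replace (eps * (4 / eps)) with 4 in HK0 by (field; lra). lra. }
  pose proof (pos_INR K) as HKp.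
  assert (Hq : 0 <= T / r) by (left; apply Rdiv_lt_0_compat; lra).
  destruct (nfloor_ex (INR K * (T / r))) as [f Hf]; [nra|].
  exists P, Q, (S f), K. fold r. rewrite S_INR.
  repeat split; auto; try (unfold K; lia); try lra.
  - apply Rmult_lt_reg_r with (T / r); [apply Rdiv_lt_0_compat; lra|].
    replace ((INR f + 1) * (r / T) * (T / r)) with (INR f + 1) by (field; lra). lra.
  - nra.
Qed.

(** Division of [n] by [K] gives [j] and the residue [i]. Half of [eps] pays for the rate
    [(1 + L)/K], the other half for the constants once [n] is large. *)
Lemma Theta_compressible U V T : optimal U -> optimal V -> 0 < T < 1 ->
  computable_real (Theta V T) -> T_compressible U T T.
Proof.
  intros HU HV HT Hcomp eps Heps.
  assert (H0 : 0 <= Theta V T) by apply (weight_sum_le_Theta V T 0 HT).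
  destruct (computable_approx _ H0 Hcomp) as [num [den [Hnum [Hden Ha]]]].
  destruct (compress_rates T (eps / 2) HT ltac:(lra))
    as [P [Q [L [K [HP [HQ [HL [HK [Hr [HLK Hrate]]]]]]]]]].
  destruct (exists_pow2_ge (Theta V (INR P / INR Q) + 1)) as [c Hc].
  destruct (compress_test_spec V T num den P Q L c K HV ltac:(lra) HP HQ Hr HL HK HLK
    ltac:(lra) Ha) as [j0 Hj0].
  (* One constant [d] for all [4 K] machines: which of them produces [T|n] depends on [n], but its
     cost must not. *)
  destruct (eventually_forall_lt (fun i d => forall a, (a < 4)%nat -> forall p z s,
    least (compress_test V num den L c P Q K i (enc p)) z ->
    (enc s = compress_value K i z + a - 2)%nat ->
    exists q, run U q s /\ (length q <= length p + d)%nat) K) as [d Hd].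
  { intros i _. destruct (eventually_forall_lt (fun a d => forall p z s,
      least (compress_test V num den L c P Q K i (enc p)) z ->
      (enc s = compress_value K i z + a - 2)%nat ->
      exists q, run U q s /\ (length q <= length p + d)%nat) 4) as [d Hd].
    - intros a _. apply compress_cost; auto.
    - exists d. intros d' Hd' a Ha4. apply Hd; auto. }
  destruct (exists_nat_ge ((1 + INR c + INR d) / (eps / 2))) as [n1 Hn1].
  exists (K * (j0 + 1) + n1)%nat. intros n Hn.
  set (j := (n / K)%nat). set (i := (n mod K)%nat).
  assert (En : (n = K * j + i)%nat) by (apply Nat.div_mod; lia).
  assert (Hi : (i < K)%nat) by (apply Nat.mod_upper_bound; lia).
  assert (Hj : (j0 <= j)%nat) by nia.
  destruct (Hj0 j i Hj Hi) as [w [Hw [Hex Hsound]]]. rewrite <- En in Hsound.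
  destruct (least_exists _ Hex) as [z Hz].
  destruct (Hsound z (proj1 Hz)) as [a [Ha4 Hval]].
  destruct (Hd i Hi d (le_n d) a Ha4 (header j w) z (restr T n) Hz) as [q [Hq Hl]].
  { pose proof (enc_restr T n HT). lia. }
  eapply Rbar_le_trans; [apply (HC_le _ _ _ Hq)|]. simpl.
  rewrite length_header, Hw in Hl. apply le_INR in Hl.
  rewrite !plus_INR, mult_INR in Hl. change (INR 1) with 1 in Hl.
  assert (H1 : (1 + INR L) * INR j <= (T + eps / 2) * INR n).
  { apply Rle_trans with ((T + eps / 2) * INR K * INR j).
    - apply Rmult_le_compat_r; auto. apply pos_INR.
    - rewrite Rmult_assoc. apply Rmult_le_compat_l; [lra|].
      rewrite <- mult_INR. apply le_INR. lia. }
  assert (H2 : 1 + INR c + INR d <= eps / 2 * INR n).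
  { apply Rmult_le_compat_l with (r := eps / 2) in Hn1; [|lra].
    replace (eps / 2 * ((1 + INR c + INR d) / (eps / 2))) with (1 + INR c + INR d)
      in Hn1 by (field; lra).
    assert (INR n1 <= INR n) by (apply le_INR; lia). nra. }
  lra.
Qed.

Theorem theorem9 (U V : mrec) (HU : optimal U) (HV : optimal V) :
  forall T : R, 0 < T < 1 ->
    computable_real (Theta V T) ->
    weakly_Chaitin_random U T T /\ T_compressible U T T.
Proof.
  intros T HT Hcomp. split.
  - apply Theta_weakly_random with V; auto.
  - apply Theta_compressible with V; auto.
Qed.
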